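(* Let $\gamma$ and $\delta$ be diagrams with $\gamma\subset\delta$ and $|\delta|=n$. Then the induced subgraph $\mathcal P_\delta$ of the Assaf graph $\mathcal H_\delta$ on the vertex set $\{\pi\in S_n:\mathrm{inv}_\delta(\pi)=0\}$ and the induced subgraph $\mathcal R_{\gamma,\delta}$ of $\mathcal H_\delta$ on the vertex set $\{\pi\in S_n:\mathrm{inv}_\delta(\pi)=0,\ \mathrm{Descent}_\delta(\pi)=\gamma\}$ (each with the signature function and colored edges inherited from $\mathcal H_\delta$) are dual equivalence graphs.
   Context: Diagram: finite $\delta\subset\mathbb Z\times\mathbb Z$ of cells $(x,y)$, numbered $1,\dots,|\delta|$ in row reading order (rows top to bottom, each left to right). $T_\delta(\pi)$ is the filling of $\delta$ with row reading word $\pi$. Pistol starting at $c=(x,y)\in\delta$: cells $(x',y)\in\delta$ with $x'\ge x$ together with cells $(x',y-1)\in\delta$ with $x'\le x$; a set of indices is $\delta$-pistoled if its cells lie in a common pistol. Statistics for a filling $T$ of $\delta$: a descent is $c=(x,y)\in\delta$ with $(x,y-1)\in\delta$ and $T(c)>T(x,y-1)$; $\mathrm{Descent}(T)$ is the set of descents. For positions $c=(x,y)$, $d=(x',y)$, $x'>x$, $e=(x,y-1)$ with $d\in\delta$: if $c,d,e\in\delta$ they form an inversion triple when $T(e)<T(d)<T(c)$ or $T(c)\le T(e)<T(d)$ or $T(d)<T(c)\le T(e)$; if $c\notin\delta$, $d,e\in\delta$, $\{d,e\}$ is an inversion pair when $T(d)>T(e)$; if $e\notin\delta$, $c,d\in\delta$,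 $\{c,d\}$ is an inversion pair when $T(c)>T(d)$. $\mathrm{inv}(T)$ = number of inversion triples plus inversion pairs. $\mathrm{inv}_\delta(\pi)=\mathrm{inv}(T_\delta(\pi))$, $\mathrm{Descent}_\delta(\pi)=\mathrm{Descent}(T_\delta(\pi))$. Signature: $\sigma(\pi)_i=+1$ iff $i$ precedes $i+1$ in $\pi$, else $-1$. $d_i$ ($1<i<n$): $d_i(\dots i\dots i{-}1\dots i{+}1\dots)=(\dots i{+}1\dots i{-}1\dots i\dots)$, $d_i(\dots i{-}1\dots i{+}1\dots i\dots)=(\dots i\dots i{+}1\dots i{-}1\dots)$, identity if $i$ lies between $i\pm1$. $\tilde d_i$: $\tilde d_i(\dots i\dots i{-}1\dots i{+}1\dots)=(\dots i{-}1\dots i{+}1\dots i\dots)$, $\tilde d_i(\dots i\dots i{+}1\dots i{-}1\dots)=(\dots i{+}1\dots i{-}1\dots i\dots)$, identity if $i$ lies between $i\pm1$. $D_i^\delta(\pi)=\tilde d_i(\pi)$ if the positions of $i-1,i,i+1$ in $\pi$ are $\delta$-pistoled, else $d_i(\pi)$. The Assaf graph $\mathcal H_\delta$: vertices $S_n$, signature $\sigma$, edges $E_i=\{\{\pi,D_i^\delta\pi\}:D_i^\delta\pi\ne\pi\}$, $2\le i\le n-1$. Signed colored graph $(V,\sigma,E)$: finite $V$, $\sigma:V\to\{\pm1\}^{n-1}$, sets $E_i$ ($2\le i\le n-1$) of pairs of distinct vertices. Isomorphisms preserve signatures and colored edges in both directions. Restriction $\mathcal G|_I$ to an integer interval $I$: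 same vertices, $\sigma'(v)_i=\sigma(v)_{\min I+i-1}$ ($1\le i\le |I|-1$), $E'_i=E_{\min I+i-1}$ ($2\le i\le|I|-1$), when defined. $\mathcal G_\lambda$ ($\lambda$ a partition, French notation): vertices the standard Young tableaux of shape $\lambda$, signature $\sigma$ of the row reading word, $i$-edges $\{T,d_i(T)\}$ for $d_i(T)\ne T$ ($d_i$ acting on the reading word). A dual equivalence graph is a signed colored graph such that (Locally Standard) for every integer interval $I$ with $|I|=6$ each component of $\mathcal G|_I$ is isomorphic to some $\mathcal G_\lambda$, and (Commuting) whenever $\{v,w\}\in E_i$, $\{w,x\}\in E_j$ with $|i-j|>2$ there is $y$ with $\{v,y\}\in E_j$, $\{x,y\}\in E_i$. *)

(* Defs.v *)
From mathcomp Require Import all_boot all_order all_algebra perm.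
From mathcomp Require Import finmap.

Set Implicit Arguments.
Unset Strict Implicit.
Unset Printing Implicit Defensive.

Import Order.TTheory GRing.Theory Num.Theory.

Local Open Scope nat_scope.
Local Open Scope fset_scope.

(* Cells (x, y) have x growing to the right and y growing upwards. *)
Definition diagram := {fset int * int}.

Definition below (c : int * int) : int * int := (c.1, c.2 - 1)%R.
Definition above (c : int * int) : int * int := (c.1, c.2 + 1)%R.

Definition reading_le (c d : int * int) : bool :=
  ((d.2 < c.2) || ((c.2 == d.2) && (c.1 <= d.1)))%R.

Definition cells (delta : diagram) : seq (int * int) := sort reading_le delta.

(* The filling T_delta(w); its values off delta are irrelevant. *)
Definition filling (delta : diagram) (w : seq nat) : int * int -> nat :=
  fun c => nth 0 w (index c (cells delta)).

Definition pistol (delta : diagram) (c : int * int) : diagram :=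
  [fset b in delta | ((b.2 == c.2) && (c.1 <= b.1)
                      || (b.2 == c.2 - 1) && (b.1 <= c.1))%R].

(* J lists positions in reading order, counted from 0. *)
Definition pistoled (delta : diagram) (J : seq nat) : bool :=
  has (fun c => all (fun k => nth (0, 0)%R (cells delta) k \in pistol delta c) J)
      (cells delta).

Definition descents (delta : diagram) (T : int * int -> nat) : diagram :=
  [fset c in delta | (below c \in delta) && (T (below c) < T c)].

(* An inversion triple (c, d, e) is recorded by (c, d), as e = below c. *)
Definition inversion_triples (delta : diagram) (T : int * int -> nat) :=
  [fset p in delta `*` delta |
    let: (c, d) := p in let e := below c in
    [&& (d.2 == c.2)%R, (c.1 < d.1)%R, e \in delta &
        [|| T e < T d < T c, T c <= T e < T d | T d < T c <= T e]]].

(* The pairs {d, e}: here e = below c for the missing cell c = above e. *)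
Definition inversion_pairs_de (delta : diagram) (T : int * int -> nat) :=
  [fset p in delta `*` delta |
    let: (d, e) := p in let c := above e in
    [&& (d.2 == c.2)%R, (c.1 < d.1)%R, c \notin delta & T e < T d]].

Definition inversion_pairs_cd (delta : diagram) (T : int * int -> nat) :=
  [fset p in delta `*` delta |
    let: (c, d) := p in let e := below c in
    [&& (d.2 == c.2)%R, (c.1 < d.1)%R, e \notin delta & T d < T c]].

Definition inv (delta : diagram) (T : int * int -> nat) : nat :=
  #|` inversion_triples delta T|
  + (#|` inversion_pairs_de delta T| + #|` inversion_pairs_cd delta T|).

(* One-line notation, with letters 1, ..., n. *)
Definition word (n : nat) (p : 'S_n) : seq nat := [seq (p k).+1 | k : 'I_n].

(* In w, the letters i-1, i, i+1 are rearranged among their own positions: the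
   subword s that they form is replaced by pat i s. *)
Definition act (pat : nat -> seq nat -> seq nat) (i : nat) (w : seq nat) :
    seq nat :=
  let s := [seq x <- w | x \in [:: i.-1; i; i.+1]] in
  [seq if x \in s then nth 0 (pat i s) (index x s) else x | x <- w].

(* d_i and \tilde d_i are involutions, so the table rows come in inverse pairs;
   the default case is that of i lying between i-1 and i+1. *)
Definition d_pat (i : nat) (s : seq nat) : seq nat :=
  if s == [:: i; i.-1; i.+1] then [:: i.+1; i.-1; i]
  else if s == [:: i.+1; i.-1; i] then [:: i; i.-1; i.+1]
  else if s == [:: i.-1; i.+1; i] then [:: i; i.+1; i.-1]
  else if s == [:: i; i.+1; i.-1] then [:: i.-1; i.+1; i]
  else s.

Definition dtilde_pat (i : nat) (s : seq nat) : seq nat :=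
  if s == [:: i; i.-1; i.+1] then [:: i.-1; i.+1; i]
  else if s == [:: i.-1; i.+1; i] then [:: i; i.-1; i.+1]
  else if s == [:: i; i.+1; i.-1] then [:: i.+1; i.-1; i]
  else if s == [:: i.+1; i.-1; i] then [:: i; i.+1; i.-1]
  else s.

Definition d_op : nat -> seq nat -> seq nat := act d_pat.
Definition dtilde_op : nat -> seq nat -> seq nat := act dtilde_pat.

Definition D_op (delta : diagram) (i : nat) (w : seq nat) : seq nat :=
  if pistoled delta [seq index x w | x <- [:: i.-1; i; i.+1]]
  then dtilde_op i w else d_op i w.

(* A signed colored graph with signatures in {+1, -1}^(deg - 1), where true
   stands for +1.  Only the entries sgn v i with 1 <= i < deg and the edge sets
   edges i with 2 <= i < deg are meaningful: values at other i are never used. *)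
Record scgraph := SCGraph {
  deg : nat;
  vert : finType;
  sgn : vert -> nat -> bool;
  edges : nat -> {set {set vert}};
  edges_pair : forall i e, e \in edges i -> #|e| = 2
}.

Definition scg_iso (G H : scgraph) : Prop :=
  deg G = deg H /\
  exists f : vert G -> vert H,
    [/\ bijective f,
        forall i v, 1 <= i < deg G -> sgn (f v) i = sgn v i
      & forall i v w, 2 <= i < deg G ->
          ([set f v; f w] \in edges H i) = ([set v; w] \in edges G i)].

Section Induced.
Variables (G : scgraph) (A : pred (vert G)).

Definition induced_edges (i : nat) : {set {set {v : vert G | A v}}} :=
  [set e : {set {v : vert G | A v}} | val @: e \in edges G i].

Lemma induced_edges_pair i e : e \in induced_edges i -> #|e| = 2.
Proof.
by rewrite inE => /edges_pair; rewrite card_imset //; apply: val_inj.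
Qed.

Definition induced : scgraph :=
  SCGraph (deg G) (fun v : {v : vert G | A v} => sgn (val v))
          induced_edges_pair.

End Induced.

(* Restriction to the interval I = {a, ..., a + k - 1}, for 1 <= a <= deg G.
   If I is not contained in {1, ..., deg G}, the signature entries and edge sets
   that exist are kept, so the degree is the size of I intersected with
   {1, ..., deg G}. *)
Definition restrict (G : scgraph) (a k : nat) : scgraph :=
  SCGraph (minn k ((deg G).+1 - a))
          (fun (v : vert G) i => sgn v (a + i - 1))
          (fun i => @edges_pair G (a + i - 1)).

Definition adj (G : scgraph) : rel (vert G) :=
  fun v w => [exists i : 'I_(deg G), (2 <= i) && ([set v; w] \in edges G i)].

Definition component (G : scgraph) (v : vert G) : scgraph :=
  induced (connect (@adj G) v).

Section WordGraph.
Variables (n : nat) (op : nat -> seq nat -> seq nat).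

Definition word_edges (i : nat) : {set {set 'S_n}} :=
  [set [set pq.1; pq.2] | pq : 'S_n * 'S_n
                        & (word pq.2 == op i (word pq.1)) && (pq.2 != pq.1)].

Lemma word_edges_pair i e : e \in word_edges i -> #|e| = 2.
Proof.
by case/imsetP=> -[p q]; rewrite inE /= => /andP[_ neq] ->; rewrite cards2 eq_sym neq.
Qed.

Definition word_graph : scgraph :=
  SCGraph n (fun (p : 'S_n) i => index i (word p) < index i.+1 (word p))
          word_edges_pair.

End WordGraph.

Definition assaf_graph (delta : diagram) : scgraph :=
  word_graph #|` delta| (D_op delta).

Definition is_partition (la : seq nat) : bool :=
  sorted geq la && all (leq 1) la.

(* French notation: the first part is the bottom row. *)
Definition young_diagram (la : seq nat) : diagram :=
  [fset c in [seq (Posz x, Posz y) | y <- iota 0 (size la),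
                                     x <- iota 0 (nth 0 la y)]].

Definition standard_filling (delta : diagram) (T : int * int -> nat) : bool :=
  all (fun c => all (fun d =>
      ((c.2 == d.2)%R && (c.1 < d.1)%R ==> (T c < T d))
      && ((c.1 == d.1)%R && (c.2 < d.2)%R ==> (T c < T d)))
    (cells delta)) (cells delta).

(* The graph G_la.  A standard Young tableau is given by its row reading word,
   which together with the shape determines it. *)
Definition tableau_graph (la : seq nat) : scgraph :=
  @induced (word_graph (sumn la) d_op)
    (fun p => standard_filling (young_diagram la)
                (filling (young_diagram la) (word p))).

Definition locally_standard (G : scgraph) : Prop :=
  forall a, 1 <= a <= deg G ->
  forall v : vert (restrict G a 6),
  exists2 la, is_partition la & scg_iso (component v) (tableau_graph la).

Definition commuting (G : scgraph) : Prop :=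
  forall i j, 2 <= i < deg G -> 2 <= j < deg G -> (i + 2 < j) || (j + 2 < i) ->
  forall v w x : vert G,
    [set v; w] \in edges G i -> [set w; x] \in edges G j ->
  exists2 y, [set v; y] \in edges G j & [set x; y] \in edges G i.

Definition dual_equivalence_graph (G : scgraph) : Prop :=
  locally_standard G /\ commuting G.

Definition P_graph (delta : diagram) : scgraph :=
  @induced (assaf_graph delta)
    (fun p => inv delta (filling delta (word p)) == 0).

Definition R_graph (gamma delta : diagram) : scgraph :=
  @induced (assaf_graph delta)
    (fun p => (inv delta (filling delta (word p)) == 0)
              && (descents delta (filling delta (word p)) == gamma)).

(* Main.v *)
(** If inv = 0, then in each row the letter j+1 never stands left of j: otherwise
    the entry below j+1 would lie strictly between j and j+1.  A filling with
    inv = 0 is moreover determined by the function rho sending each letter to its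
    row, since each entry is the cyclically first remaining one after the entry
    below it.  The point is that D_i acts on rho exactly as d_i acts on the word
    listing the letters from the top row down, increasingly in each row.  If
    i-1, i, i+1 are not pistoled, then the two letters exchanged by d_i share no
    pistol, hence no triple.  If they are, then inv = 0 leaves only the patterns
    312 and 231 with the first letter directly above the third, and the rotation
    keeps the cyclic order in the one triple that sees the second letter.  So
    inv = 0 and the descents are preserved, and locally the graph is that of words
    under d_i, whose components of degree at most 6 are identified with the G_la
    by Robinson-Schensted insertion, a finite verification. *)

Require Import Defs.
From mathcomp Require Import all_boot all_order all_algebra perm.
From mathcomp Require Import finmap zify.
Set Implicit Arguments.
Unset Strict Implicit.
Unset Printing Implicit Defensive.

Local Open Scope fset_scope.

(** * The operator d_i as a letter permutation *)

Definition swap (a b x : nat) : nat :=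
  if x == a then b else if x == b then a else x.

Lemma swapK a b : involutive (swap a b).
Proof.
move=> x; rewrite /swap; case: (eqVneq x a) => [->|xa].
  by rewrite eqxx; case: eqVneq.
by case: (eqVneq x b) => [->|xb]; rewrite ?eqxx // (negPf xa) (negPf xb).
Qed.

Definition prec (w : seq nat) (i j : nat) := index i w < index j w.

Definition between (pr : rel nat) x y z := pr x y && pr y z || pr z y && pr y x.

(* The letter permutation by which d_i acts on a word whose precedence relation
   is [pr]. *)
Definition dswap (pr : rel nat) (i : nat) : nat -> nat :=
  if between pr i i.-1 i.+1 then swap i i.+1
  else if between pr i.-1 i.+1 i then swap i.-1 i
  else id.

Lemma dswapK pr i : involutive (dswap pr i).
Proof. by move=> x; rewrite /dswap; do 2?case: ifP => _ //; apply: swapK. Qed.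

Lemma eq_dswap (pr pr' : rel nat) i :
  {in [:: i.-1; i; i.+1] &, forall a b, pr a b = pr' a b} -> dswap pr i = dswap pr' i.
Proof. by move=> e; rewrite /dswap /between !e ?inE ?eqxx ?orbT. Qed.

(** Both lists are strictly increasing for the position in [w] and have the same members, so they
    coincide. *)
Lemma subword3 (w : seq nat) (a b c : nat) :
  uniq w -> a \in w -> b \in w -> c \in w -> prec w a b -> prec w b c ->
  [seq x <- w | x \in [:: a; b; c]] = [:: a; b; c].
Proof.
move=> uw aw bw cw ab bc.
have sw : sorted (relpre (index^~ w) ltn) w.
  suff e : map (index^~ w) w = iota 0 (size w).
    by rewrite -(@sorted_map _ _ (index^~ w) ltn) e iota_ltn_sorted.
  apply: (@eq_from_nth _ 0); rewrite size_map ?size_iota // => i iw.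
  by rewrite (nth_map 0) // index_uniq // nth_iota.
rewrite /prec in ab bc.
apply: (@irr_sorted_eq _ (relpre (index^~ w) ltn)) => //.
- by move=> x y z /=; apply: ltn_trans.
- by move=> x /=; rewrite ltnn.
- by apply: sorted_filter => // x y z /=; apply: ltn_trans.
- by rewrite /= ab bc.
- move=> x; rewrite mem_filter !inE; apply: andb_idr.
  by case/or3P => /eqP->.
Qed.

Definition subst3 (a b c a' b' c' x : nat) : nat :=
  if x == a then a' else if x == b then b' else if x == c then c' else x.

(** [act] keeps the three positions and changes only which letters occupy them, so on a word with
    distinct letters it is one and the same letter substitution everywhere. *)
Lemma actE pat i w a b c a' b' c' : uniq w -> {subset [:: a; b; c] <= w} ->
  prec w a b -> prec w b c -> perm_eq [:: a; b; c] [:: i.-1; i; i.+1] ->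
  pat i [:: a; b; c] = [:: a'; b'; c'] ->
  act pat i w = map (subst3 a b c a' b' c') w.
Proof.
move=> uw sw ab bc pe pp; rewrite /act.
have -> : [seq x <- w | x \in [:: i.-1; i; i.+1]] = [:: a; b; c].
  rewrite -(subword3 uw _ _ _ ab bc) ?sw ?inE ?eqxx ?orbT //.
  by apply: eq_filter => x; rewrite -(perm_mem pe).
rewrite pp; apply: eq_map => x; rewrite /subst3 !inE /=.
rewrite ![a == x]eq_sym ![b == x]eq_sym ![c == x]eq_sym.
by case: eqP => //=; case: eqP => //=; case: eqP.
Qed.

Lemma prec_total w a b : a \in w -> b \in w -> a != b -> prec w a b || prec w b a.
Proof.
move=> aw bw; apply: contraR; rewrite /prec negb_or -!leqNgt -eqn_leq.
by move=> /eqP e; rewrite (index_inj 0 aw bw).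
Qed.

Lemma succ_neq : (forall k, (k == k.+1) = false) * (forall k, (k == k.+2) = false)
  * (forall k, (k.+1 == k) = false) * (forall k, (k.+2 == k) = false).
Proof. by do ![split]; lia. Qed.

Lemma d_opE w i : 0 < i -> uniq w -> {subset [:: i.-1; i; i.+1] <= w} ->
  d_op i w = map (dswap (prec w) i) w.
Proof.
case: i => // j _ uw sw.
have [aw bw cw] : [/\ j \in w, j.+1 \in w & j.+2 \in w].
  by split; apply: sw; rewrite /= !inE eqxx ?orbT.
have [t1 t2 t3] : [/\ prec w j j.+1 || prec w j.+1 j, prec w j j.+2 || prec w j.+2 j
                     & prec w j.+1 j.+2 || prec w j.+2 j.+1].
  by split; apply: prec_total => //; lia.
have act3 a b c a' b' c' : prec w a b -> prec w b c ->
    perm_eq [:: a; b; c] [:: j; j.+1; j.+2] ->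
    d_pat j.+1 [:: a; b; c] = [:: a'; b'; c'] ->
    dswap (prec w) j.+1 =1 subst3 a b c a' b' c' ->
    d_op j.+1 w = map (dswap (prec w) j.+1) w.
  move=> ab bc pe pp e; rewrite (eq_map e); apply: actE pp => //.
  by move=> x; rewrite (perm_mem pe); apply: sw.
have anti x y : prec w x y -> prec w y x = false by rewrite /prec => h; rewrite ltnNge (ltnW h).
(* Three comparisons give eight cases: six are the orders of the three letters, the third and the
   sixth are cyclic and hence impossible. *)
case/orP: t1 => p1; case/orP: t2 => p2; case/orP: t3 => p3;
  move: (anti _ _ p1) (anti _ _ p2) (anti _ _ p3) => m1 m2 m3;
  [apply: (act3 _ _ _ _ _ _ p1 p3) | apply: (act3 _ _ _ _ _ _ p2 p3)
  | by move: p1 p2 p3; rewrite /prec; clear; lia | apply: (act3 _ _ _ _ _ _ p2 p1)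
  | apply: (act3 _ _ _ _ _ _ p1 p2) | by move: p1 p2 p3; rewrite /prec; clear; lia
  | apply: (act3 _ _ _ _ _ _ p3 p2) | apply: (act3 _ _ _ _ _ _ p3 p1)];
  rewrite ?/d_pat /= ?eqseq_cons ?(succ_neq, eqxx) /= //.
all: try by rewrite /perm_eq /= ?(succ_neq, eqxx).
all: move=> x; rewrite /dswap /between /= ?m1 ?m2 ?m3 ?p1 ?p2 ?p3 /= /swap /subst3.
all: by clear; case: (x =P j) => ?; case: (x =P j.+1) => ?; case: (x =P j.+2) => ?; lia.
Qed.

(** * Fillings and inversions *)

Lemma reading_le_total : total reading_le.
Proof. by case=> a b [c d]; rewrite /reading_le /=; lia. Qed.

Lemma reading_le_trans : transitive reading_le.
Proof. by case=> a b [c d] [e f]; rewrite /reading_le /=; lia. Qed.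

Definition reading_lt (c d : int * int) : bool :=
  ((d.2 < c.2) || ((c.2 == d.2) && (c.1 < d.1)))%R.

Lemma mem_cells delta : cells delta =i delta.
Proof. by move=> c; rewrite mem_sort. Qed.

Lemma cells_uniq delta : uniq (cells delta).
Proof. by rewrite sort_uniq fset_uniq. Qed.

Lemma size_cells delta : size (cells delta) = #|` delta|.
Proof. by rewrite size_sort. Qed.

Lemma cells_sorted delta : sorted reading_le (cells delta).
Proof. exact: (sort_sorted reading_le_total). Qed.

Lemma index_cells (delta : diagram) : {in delta &, forall c d,
  (index c (cells delta) < index d (cells delta)) = reading_lt c d}.
Proof.
move=> c d cD dD; have [cC dC] : c \in cells delta /\ d \in cells delta.
  by rewrite !mem_cells.
have le := sorted_ltn_index reading_le_trans (cells_sorted delta).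
case: (ltngtP (index c (cells delta)) (index d (cells delta))) => h.
- have ne : c != d by apply: contraL h => /eqP->; rewrite ltnn.
  move: (le _ _ cC dC h) ne; case: c d {cD dD cC dC le h} => a b [e f] /=.
  by rewrite /reading_le /reading_lt /= xpair_eqE; lia.
- move: (le _ _ dC cC h); case: c d {cD dD cC dC le h} => a b [e f] /=.
  by rewrite /reading_le /reading_lt /=; lia.
- rewrite (index_inj (0, 0)%R cC dC h); case: d {cD dD cC dC le h} => a b.
  by rewrite /reading_lt /=; lia.
Qed.

Definition cell (delta : diagram) (w : seq nat) (j : nat) : int * int :=
  nth (0, 0)%R (cells delta) (index j w).

Definition letter_row (delta : diagram) (w : seq nat) (j : nat) : int := (cell delta w j).2.

Section Words.
Variables (delta : diagram) (w : seq nat).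
Hypothesis ww : perm_eq w (iota 1 #|` delta|).

Lemma letters_uniq : uniq w.
Proof. by rewrite (perm_uniq ww) iota_uniq. Qed.

Lemma mem_word j : (j \in w) = (0 < j <= #|` delta|).
Proof. by rewrite (perm_mem ww) mem_iota add1n ltnS. Qed.

Lemma size_letters : size w = size (cells delta).
Proof. by rewrite (perm_size ww) size_iota size_cells. Qed.

Lemma filling_mem c : c \in delta -> filling delta w c \in w.
Proof.
by move=> cD; rewrite /filling mem_nth // size_letters index_mem mem_cells.
Qed.

Lemma filling_cell j : j \in w -> filling delta w (cell delta w j) = j.
Proof.
move=> jw; rewrite /filling /cell index_uniq ?cells_uniq ?nth_index //.
by rewrite -size_letters index_mem.
Qed.

Lemma cell_filling c : c \in delta -> cell delta w (filling delta w c) = c.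
Proof.
move=> cD; rewrite /filling /cell index_uniq ?letters_uniq ?nth_index //.
  by rewrite mem_cells.
by rewrite size_letters index_mem mem_cells.
Qed.

Lemma cell_in j : j \in w -> cell delta w j \in delta.
Proof. by move=> jw; rewrite -mem_cells mem_nth // -size_letters index_mem. Qed.

Lemma filling_inj : {in delta &, injective (filling delta w)}.
Proof. by move=> c d /cell_filling {2}<- /cell_filling {2}<- ->. Qed.

Lemma cell_inj : {in w &, injective (cell delta w)}.
Proof. by move=> i j /filling_cell {2}<- /filling_cell {2}<- ->. Qed.

Lemma prec_cell : {in w &, forall i j,
  prec w i j = reading_lt (cell delta w i) (cell delta w j)}.
Proof.
move=> i j iw jw; rewrite -(index_cells (cell_in iw) (cell_in jw)) /cell.
by rewrite !index_uniq ?cells_uniq // -size_letters index_mem.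
Qed.

Lemma filling_map g c : c \in delta -> filling delta (map g w) c = g (filling delta w c).
Proof.
by move=> cD; rewrite /filling (nth_map 0) // size_letters index_mem mem_cells.
Qed.

Lemma cell_map g j : injective g -> cell delta (map g w) (g j) = cell delta w j.
Proof. by move=> ig; rewrite /cell index_map. Qed.

Lemma word_filling : w = map (filling delta w) (cells delta).
Proof.
apply: (@eq_from_nth _ 0); first by rewrite size_map size_letters.
by rewrite size_letters => i ic; rewrite (nth_map (0, 0)%R) // /filling index_uniq ?cells_uniq.
Qed.

End Words.

Definition cyc (a b c : nat) : bool := [|| a < b < c, b < c < a | c < a < b].

(* Giving absent cells the value 0, below all letters, turns the triples and both
   kinds of pairs into a single condition: c, d, e are cyclically increasing. *)
Definition ext (delta : diagram) (T : int * int -> nat) (c : int * int) : nat :=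
  if c \in delta then T c else 0.

(** Here [c] is only a position. Requiring one of [c] and [below c] to be a cell covers the triples
    and both kinds of pairs. *)
Definition noinv (delta : diagram) (T : int * int -> nat) : Prop :=
  forall c d, d \in delta -> c.2 = d.2 -> (c.1 < d.1)%R ->
    (c \in delta) || (below c \in delta) ->
    cyc (ext delta T c) (ext delta T d) (ext delta T (below c)).

Lemma above_below c : above (below c) = c.
Proof. by case: c => x y; rewrite /above /below /=; congr pair; lia. Qed.

Lemma below_above c : below (above c) = c.
Proof. by case: c => x y; rewrite /above /below /=; congr pair; lia. Qed.

(** For distinct entries an inversion triple is one that decreases cyclically. If [c] is absent, its
    value 0 reduces [cyc] to T(d) < T(e); if [e] is absent, to T(c) < T(d). *)
Lemma inv_eq0P (delta : diagram) (T : int * int -> nat) :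
  {in delta &, injective T} -> {in delta, forall c, 0 < T c} ->
  Defs.inv delta T = 0 <-> noinv delta T.
Proof.
move=> Ti T0; split.
- move/eqP; rewrite /Defs.inv !addn_eq0 !cardfs_eq0 => /and3P[/eqP e1 /eqP e2 /eqP e3].
  move=> c d dD cd lt; rewrite /ext dD.
  have ncd : c <> d by move=> e; rewrite e Order.POrderTheory.ltxx in lt.
  have nde : d <> below c.
    by case: c d cd {dD lt ncd} => a b [a' b'] /= -> []; lia.
  case: ifP => cD; case: ifP => eD // _.
  + have : (c, d) \notin inversion_triples delta T by rewrite e1 in_fset0.
    rewrite !inE /= cD dD cd eqxx lt eD /= /cyc.
    have n1 : T c <> T d by move=> /(Ti _ _ cD dD).
    have n2 : T d <> T (below c) by move=> /(Ti _ _ dD eD).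
    by lia.
  + have : (c, d) \notin inversion_pairs_cd delta T by rewrite e3 in_fset0.
    rewrite !inE /= cD dD cd eqxx lt eD /= /cyc.
    have n1 : T c <> T d by move=> /(Ti _ _ cD dD).
    by move: (T0 _ cD) (T0 _ dD); lia.
  + have : (d, below c) \notin inversion_pairs_de delta T by rewrite e2 in_fset0.
    rewrite !inE /= above_below eD dD cd GRing.subrK eqxx lt cD /= /cyc.
    have n2 : T d <> T (below c) by move=> /(Ti _ _ dD eD).
    by move: (T0 _ eD) (T0 _ dD); lia.
- move=> h; apply/eqP; rewrite /Defs.inv !addn_eq0 !cardfs_eq0; apply/and3P; split;
  apply/eqP/fsetP => -[c d]; rewrite !inE /=; apply/negP.
  + case/and3P=> /andP[cD dD] /eqP cd /and3P[lt eD].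
    have := h c d dD (esym cd) lt; rewrite cD eD /= /ext cD dD eD => /(_ isT).
    by rewrite /cyc; lia.
  + case/and3P=> /andP[dD eD] /eqP cd /and3P[lt cD] l2.
    (* In this case the pair is of kind (d, e), so the names are shifted: the missing corner lies
       above the second component. *)
    have := h (above d) c dD _ lt; rewrite below_above eD orbT.
    have -> : (above d).2 = c.2 by rewrite /= cd.
    rewrite /ext (negPf cD) dD eD => /(_ erefl isT).
    by rewrite /cyc; lia.
  + case/and3P=> /andP[cD dD] /eqP cd /and3P[lt eD] l2.
    have := h c d dD (esym cd) lt; rewrite cD (negPf eD) /= /ext cD dD (negPf eD) => /(_ isT).
    by rewrite /cyc; move: (T0 _ cD); lia.
Qed.

(** * Invariance of inv = 0 and of the descents *)

(* Precedence in the word listing the letters by decreasing row, increasingly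
   within each row. *)
Definition prec_row (rho : nat -> int) (a b : nat) : bool :=
  ((rho b < rho a) || ((rho a == rho b) && (a < b)%N))%R.

Lemma map_letters n w g : perm_eq w (iota 1 n) -> injective g ->
  {in w, forall j, g j \in w} -> perm_eq (map g w) (iota 1 n).
Proof.
move=> ww ig gw; apply: (perm_trans _ ww).
have uw : uniq w by rewrite (perm_uniq ww) iota_uniq.
have um : uniq (map g w) by rewrite map_inj_uniq.
apply: uniq_perm => //; apply: (uniq_min_size um _ _).2; last by rewrite size_map.
by move=> x /mapP[j /gw ? ->].
Qed.

(** A pistol is the end of one row followed by the beginning of the next, hence an interval of the
    reading order. *)
Lemma pistol_interval delta c : {in delta & &, forall a m b,
  a \in pistol delta c -> b \in pistol delta c ->
  reading_lt a m -> reading_lt m b -> m \in pistol delta c}.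
Proof.
case: c => x y [xa ya] [xm ym] [xb yb] aD mD bD.
by rewrite !inE /reading_lt /= aD mD bD /=; lia.
Qed.

(** The pistol starting at the earlier of the two cells contains the other: that of [c] contains [d]
    and [below c], that of [d] contains [below c]. *)
Lemma triple_pistol (delta : diagram) c d p q :
  c.2 = d.2 -> (c.1 < d.1)%R -> p != q -> p \in delta -> q \in delta ->
  p \in [:: c; d; below c] -> q \in [:: c; d; below c] ->
  exists2 r, r \in delta & (p \in pistol delta r) && (q \in pistol delta r).
Proof.
move=> e lt pq pD qD.
have W r : r \in delta -> (p \in pistol delta r) && (q \in pistol delta r) ->
  exists2 r, r \in delta & (p \in pistol delta r) && (q \in pistol delta r).
  by exists r.
have P a b : (a \in pistol delta b) = (a \in delta) &&
   (((a.2 == b.2) && (b.1 <= a.1) || (a.2 == b.2 - 1) && (a.1 <= b.1))%R) by rewrite !inE.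
case: c d e lt => x y [x' y'] /= e lt; subst y'.
rewrite !inE; case/or3P => /eqP ep; case/or3P => /eqP eq; subst p q;
  rewrite ?eqxx // in pq.
all: first [by apply: (W _ pD); rewrite !P pD qD /=; lia
           |by apply: (W _ qD); rewrite !P pD qD /=; lia].
Qed.

Lemma ext_cell delta w z c : perm_eq w (iota 1 #|` delta|) ->
  ext delta (filling delta w) c = z -> 0 < z -> [/\ c \in delta, cell delta w z = c & z \in w].
Proof.
rewrite /ext => ww; case: ifP => cD <- // _.
by rewrite (cell_filling ww) ?(filling_mem ww).
Qed.

Lemma ext_filling_cell delta w z : perm_eq w (iota 1 #|` delta|) -> z \in w ->
  ext delta (filling delta w) (cell delta w z) = z.
Proof. by move=> ww zw; rewrite /ext (cell_in ww) // (filling_cell ww). Qed.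

Lemma ext_map delta w g c : perm_eq w (iota 1 #|` delta|) -> g 0 = 0 ->
  ext delta (filling delta (map g w)) c = g (ext delta (filling delta w) c).
Proof. by rewrite /ext => ww g0; case: ifP => // cD; rewrite (filling_map ww). Qed.

(** No value lies strictly between [j] and [j.+1], so their exchange is invisible in a triple that
    does not contain both. *)
Lemma cyc_swap j u v t : cyc u v t ->
  ~~ all (mem [:: u; v; t]) [:: j; j.+1] ->
  cyc (swap j j.+1 u) (swap j j.+1 v) (swap j j.+1 t).
Proof.
by rewrite /cyc /swap /= !inE ![_ == j]eq_sym ![_ == j.+1]eq_sym;
  case: (j =P u); case: (j =P v); case: (j =P t);
  case: (j.+1 =P u); case: (j.+1 =P v); case: (j.+1 =P t) => /=; lia.
Qed.

Lemma ltn_swap j u v : ~~ all (mem [:: u; v]) [:: j; j.+1] ->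
  (swap j j.+1 u < swap j j.+1 v) = (u < v).
Proof.
by rewrite /swap /= !inE ![_ == j]eq_sym ![_ == j.+1]eq_sym;
  case: (j =P u); case: (j =P v);
  case: (j.+1 =P u); case: (j.+1 =P v) => /=; lia.
Qed.

Lemma apart_triple delta w j : perm_eq w (iota 1 #|` delta|) -> 0 < j ->
  (forall r, r \in delta -> ~~ ((cell delta w j \in pistol delta r)
                               && (cell delta w j.+1 \in pistol delta r))) ->
  forall c d, c.2 = d.2 -> (c.1 < d.1)%R ->
  ~~ all (mem (map (ext delta (filling delta w)) [:: c; d; below c])) [:: j; j.+1].
Proof.
move=> ww j0 np c d e lt; apply/negP => /and3P[/mapP[p pi ep] /mapP[q qi eq] _].
(* Both letters are positive, so they are entries of actual cells and not the value 0 of an absent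
   one. *)
have [pD cp _] := ext_cell ww (esym ep) j0.
have [qD cq _] := ext_cell ww (esym eq) (ltn0Sn j).
have pq : p != q by apply/eqP => h; move: ep; rewrite h -eq; lia.
have [r rD] := triple_pistol e lt pq pD qD pi qi.
by apply/negP; rewrite -cp -cq np.
Qed.

Lemma noinv_swap delta w j : perm_eq w (iota 1 #|` delta|) -> 0 < j ->
  (forall r, r \in delta -> ~~ ((cell delta w j \in pistol delta r)
                               && (cell delta w j.+1 \in pistol delta r))) ->
  noinv delta (filling delta w) -> noinv delta (filling delta (map (swap j j.+1) w)).
Proof.
move=> ww j0 np NI c d dD e lt h.
have s0 : swap j j.+1 0 = 0 by case: (j) j0.
by rewrite !(ext_map _ ww s0); apply: cyc_swap (apart_triple ww j0 np e lt); apply: NI.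
Qed.

Lemma descents_swap delta w j : perm_eq w (iota 1 #|` delta|) -> 0 < j ->
  (forall r, r \in delta -> ~~ ((cell delta w j \in pistol delta r)
                               && (cell delta w j.+1 \in pistol delta r))) ->
  descents delta (filling delta (map (swap j j.+1) w)) = descents delta (filling delta w).
Proof.
move=> ww j0 np; apply/fsetP => c; rewrite !inE /=; apply: andb_id2l => cD.
apply: andb_id2l => eD; rewrite !(filling_map ww) // ltn_swap //.
(* The pair formed by [c] and [below c] is completed to a triple by the position to the right of
   [c], which need not be a cell. *)
have lt : (c.1 < (c.1 + 1, c.2).1)%R by rewrite /=; lia.
have := apart_triple ww j0 np (erefl c.2 : c.2 = (_, _).2) lt.
apply: contra; rewrite /= /ext cD eD !inE !andbT.
by case/andP => /orP[/eqP->|/eqP->] /orP[/eqP->|/eqP->]; rewrite !eqxx ?orbT.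
Qed.

(* The rotations made by \tilde d_i on the patterns 312 and 231, with i = j+1. *)
Definition rotation (j a b c a' b' c' : nat) : Prop :=
  (a, b, c, a', b', c') = (j.+2, j, j.+1, j.+1, j.+2, j) \/
  (a, b, c, a', b', c') = (j.+1, j.+2, j, j.+2, j, j.+1).

(** The rotation keeps the relative order of [a] and [c] and moves only [b] past them. A triple that
    contains [b] and another of the three letters is by hypothesis the triple (a, b, c) itself, and
    its image is again cyclically increasing. *)
Lemma cyc_rot a b c a' b' c' j u v t :
  rotation j a b c a' b' c' ->
  cyc u v t ->
  (b \in [:: u; v; t] -> (a \in [:: u; v; t]) || (c \in [:: u; v; t]) ->
     [/\ u = a, v = b & t = c]) ->
  cyc (subst3 a b c a' b' c' u) (subst3 a b c a' b' c' v) (subst3 a b c a' b' c' t).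
Proof.
have E x : [\/ x = j, x = j.+1, x = j.+2 | [/\ (j == x) = false, (j.+1 == x) = false,
   (j.+2 == x) = false & x < j \/ j.+2 < x]].
  case: (j =P x) => ?; first by constructor 1.
  case: (j.+1 =P x) => ?; first by constructor 2.
  case: (j.+2 =P x) => ?; first by constructor 3.
  by constructor 4; split=> //; lia.
case=> -[-> -> -> -> -> ->]; rewrite /cyc /subst3 !inE;
  rewrite ![u == _]eq_sym ![v == _]eq_sym ![t == _]eq_sym;
  case: (E u) => [->|->|->|[-> -> -> ?]];
  case: (E v) => [->|->|->|[-> -> -> ?]];
  case: (E t) => [->|->|->|[-> -> -> ?]];
  rewrite ?(succ_neq, eqxx) /=; try lia.
all: by move=> _ /(_ isT isT)[]; lia.
Qed.

Lemma ltn_rot a b c a' b' c' j u v : rotation j a b c a' b' c' ->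
  (b \in [:: u; v] -> (a \in [:: u; v]) || (c \in [:: u; v]) -> False) ->
  (subst3 a b c a' b' c' u < subst3 a b c a' b' c' v) = (u < v).
Proof.
by case=> -[-> -> -> -> -> ->]; rewrite /subst3 !inE ![_ == u]eq_sym ![_ == v]eq_sym;
  do ![case: eqP => //= ?]; lia.
Qed.

(** The cell of [b] lies to the right of that of [a], in the same row, and that of [c] just below
    that of [a]. If [b] sat at [p] or [below p], the cells of [a] and [c] would be outside the
    triple; so [b] sits at [q], which puts [a] at [p]. *)
Lemma corner_triple delta w a b c : perm_eq w (iota 1 #|` delta|) ->
  {subset [:: a; b; c] <= w} -> letter_row delta w a = letter_row delta w b ->
  ((cell delta w a).1 < (cell delta w b).1)%R ->
  below (cell delta w a) = cell delta w c ->
  forall p q, p.2 = q.2 -> (p.1 < q.1)%R ->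
  let U := ext delta (filling delta w) in
  b \in map U [:: p; q; below p] ->
  (a \in map U [:: p; q; below p]) || (c \in map U [:: p; q; below p]) ->
  [/\ U p = a, U q = b & U (below p) = c].
Proof.
move=> ww sw rab lab bac p q pq lpq U.
have [aw bw cw] : [/\ a \in w, b \in w & c \in w].
  by split; apply: sw; rewrite !inE eqxx ?orbT.
have E z : z \in w -> z \in map U [:: p; q; below p] ->
    cell delta w z \in [:: p; q; below p].
  rewrite (mem_word ww) => /andP[z0 _] /mapP[x xi /esym ex].
  by have [_ -> _] := ext_cell ww ex z0.
have fin : cell delta w a = p -> cell delta w b = q ->
    [/\ U p = a, U q = b & U (below p) = c].
  by move=> <- <-; rewrite bac /U !ext_filling_cell.
move=> /(E _ bw) bi ac; suff : cell delta w a = p /\ cell delta w b = q by case.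
have {ac} ac : (cell delta w a \in [:: p; q; below p]) || (cell delta w c \in [:: p; q; below p]).
  by case/orP: ac => h; rewrite (E _ _ h) ?orbT.
move: bi ac rab lab bac {fin E}; rewrite /letter_row !inE.
case: (cell delta w a) (cell delta w b) (cell delta w c) => [xa ya] [xb yb] [xc yc].
case: p q pq lpq => [x y] [x' y'] /= -> lt bi ac rab lab [e1 e2].
suff [-> -> -> ->] : [/\ xa = x, ya = y', xb = x' & yb = y'] by [].
move: lt bi ac rab lab e1 e2; rewrite /= !xpair_eqE /= => lt bi ac rab lab e1 e2; split; lia.
Qed.

Lemma noinv_rot delta w a b c a' b' c' j : perm_eq w (iota 1 #|` delta|) -> 0 < j ->
  rotation j a b c a' b' c' ->
  {subset [:: a; b; c] <= w} -> letter_row delta w a = letter_row delta w b ->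
  ((cell delta w a).1 < (cell delta w b).1)%R ->
  below (cell delta w a) = cell delta w c ->
  noinv delta (filling delta w) ->
  noinv delta (filling delta (map (subst3 a b c a' b' c') w)).
Proof.
move=> ww j0 rot sw rab lab bac NI p q qD e lt h.
have s0 : subst3 a b c a' b' c' 0 = 0.
  by case: rot => -[-> -> -> -> -> ->]; rewrite /subst3; case: (j) j0.
rewrite !(ext_map _ ww s0); apply: (cyc_rot rot); first exact: NI.
exact: (corner_triple ww sw rab lab bac e lt).
Qed.

Lemma descents_rot delta w a b c a' b' c' j : perm_eq w (iota 1 #|` delta|) ->
  rotation j a b c a' b' c' ->
  {subset [:: a; b; c] <= w} -> letter_row delta w a = letter_row delta w b ->
  ((cell delta w a).1 < (cell delta w b).1)%R ->
  below (cell delta w a) = cell delta w c ->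
  descents delta (filling delta (map (subst3 a b c a' b' c') w))
  = descents delta (filling delta w).
Proof.
move=> ww rot sw rab lab bac; apply/fsetP => p; rewrite !inE /=.
apply: andb_id2l => pD; apply: andb_id2l => eD.
rewrite !(filling_map ww) // (ltn_rot rot) // => bi aci.
have lt : (p.1 < (p.1 + 1, p.2).1)%R by rewrite /=; lia.
have := corner_triple ww sw rab lab bac (erefl p.2 : p.2 = (_, _).2) lt.
have I z : z \in [:: filling delta w (below p); filling delta w p] ->
   z \in map (ext delta (filling delta w)) [:: p; (p.1 + 1, p.2)%R; below p].
  by rewrite /= /ext pD eD !inE => /orP[]->; rewrite ?orbT.
case; [exact: I | by case/orP: aci => h; rewrite (I _ h) ?orbT |].
rewrite /ext pD eD => pa _ ec.
have [bw ab cb] : [/\ b \in w, a != b & c != b].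
  split; first by apply: sw; rewrite !inE eqxx orbT.
    by apply: contraTN lab => /eqP->; rewrite Order.POrderTheory.ltxx.
  by case: rot => -[_ -> -> _ _ _]; lia.
by move: bi; rewrite !inE pa ec ![b == _]eq_sym (negPf ab) (negPf cb).
Qed.

(** Otherwise [u] would lie strictly between [j] and [j.+1]; in [cyc_gap] the only value strictly
    between is [j.+1]. *)
Lemma cyc_succ u j : cyc u j.+1 j = false.
Proof. by rewrite /cyc; lia. Qed.

Lemma cyc_gap u j : cyc u j.+2 j -> u = j.+1.
Proof. by rewrite /cyc; lia. Qed.

(** * One application of D_i to an inversion-free word *)

Section Step.
Variables (delta : diagram) (w : seq nat).
Hypothesis ww : perm_eq w (iota 1 #|` delta|).
Hypothesis NI : noinv delta (filling delta w).
Let C := cell delta w.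
Let U := ext delta (filling delta w).
Let R := letter_row delta w.

Lemma noinv_letters a b : a \in w -> b \in w -> R a = R b -> ((C a).1 < (C b).1)%R ->
  cyc a b (U (below (C a))).
Proof.
move=> aw bw ab lt; have := NI (cell_in ww bw) ab lt.
by rewrite (cell_in ww aw) !(ext_filling_cell ww) //; apply.
Qed.

(** This is the triple whose corner is the position above [a], possibly not a cell, with [a] as its
    lower entry. *)
Lemma noinv_below a b : a \in w -> b \in w -> (R b = R a + 1)%R -> ((C a).1 < (C b).1)%R ->
  cyc (U (above (C a))) b a.
Proof.
move=> aw bw ab lt; have := @NI (above (C a)) _ (cell_in ww bw) (esym ab) lt.
rewrite below_above (cell_in ww aw) orbT => /(_ isT).
by rewrite !(ext_filling_cell ww).
Qed.

Lemma prec_letters a b : a \in w -> b \in w ->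
  prec w a b = ((R b < R a) || ((R a == R b) && ((C a).1 < (C b).1)))%R.
Proof. exact: prec_cell. Qed.

Lemma letter_left a b : a \in w -> b \in w -> a != b -> R a = R b ->
  ((C a).1 < (C b).1)%R || ((C b).1 < (C a).1)%R.
Proof.
move=> aw bw ne ab; have : C a != C b by apply: contra ne => /eqP /(cell_inj ww aw bw)->.
move: ab; rewrite /R /letter_row -/C.
by case: (C a) (C b) => x y [x' y'] /= ->; rewrite xpair_eqE; lia.
Qed.

Lemma row_succ_left j : j \in w -> j.+1 \in w -> R j = R j.+1 -> ((C j).1 < (C j.+1).1)%R.
Proof.
move=> jw jw1 e; have /orP[] // := letter_left jw jw1 (ltac:(lia) : j != j.+1) e.
by move/(noinv_letters jw1 jw (esym e)); rewrite /cyc; lia.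
Qed.

Lemma prec_succ j : j \in w -> j.+1 \in w ->
  prec w j j.+1 = prec_row R j j.+1 /\ prec w j.+1 j = prec_row R j.+1 j.
Proof.
move=> jw jw1; rewrite !prec_letters // /prec_row.
by case: (R j =P R j.+1) => [/(row_succ_left jw jw1)|]; lia.
Qed.

(** Reading order and row order can disagree only when [j.+2] stands left of [j] in a common row.
    The entry below [j.+2] is then strictly between [j] and [j.+2], which makes it [j.+1]. *)
Lemma prec_gap j : {subset [:: j; j.+1; j.+2] <= w} ->
  prec w j j.+2 = prec_row R j j.+2 /\ prec w j.+2 j = prec_row R j.+2 j \/
  [/\ R j.+2 = R j, ((C j.+2).1 < (C j).1)%R & below (C j.+2) = C j.+1].
Proof.
move=> sw; have [w0 w2] : j \in w /\ j.+2 \in w by split; apply: sw; rewrite !inE eqxx ?orbT.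
rewrite !prec_letters // /prec_row; case: (R j =P R j.+2) => [e|]; last by lia.
have /orP[lt|lt] := letter_left w0 w2 (ltac:(lia) : j != j.+2) e; first by lia.
right; split=> //; have := noinv_letters w2 w0 (esym e) lt.
have e1 : cyc j.+2 j (U (below (C j.+2))) -> U (below (C j.+2)) = j.+1 by rewrite /cyc; lia.
by move/e1 => /(ext_cell ww)/(_ (ltn0Sn j))[].
Qed.

Lemma pistoled_index a b c : {subset [:: a; b; c] <= w} ->
  pistoled delta [seq index x w | x <- [:: a; b; c]] <->
  exists2 p, p \in delta & [/\ C a \in pistol delta p, C b \in pistol delta p
                             & C c \in pistol delta p].
Proof.
move=> sw; rewrite /pistoled; split.
  case/hasP => p; rewrite mem_cells => pD /and4P[h1 h2 h3 _].
  by exists p.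
by case=> p pD [h1 h2 h3]; apply/hasP; exists p; rewrite ?mem_cells //= -!/(C _) h1 h2 h3.
Qed.

Section Triple.
Variable j : nat.
Hypothesis sw : {subset [:: j; j.+1; j.+2] <= w}.

Let w0 : j \in w. Proof. by apply: sw; rewrite !inE eqxx. Qed.
Let w1 : j.+1 \in w. Proof. by apply: sw; rewrite !inE eqxx orbT. Qed.
Let w2 : j.+2 \in w. Proof. by apply: sw; rewrite !inE eqxx !orbT. Qed.

Lemma dtilde_idE : prec w j j.+1 && prec w j.+1 j.+2 || prec w j.+2 j.+1 && prec w j.+1 j ->
  dtilde_op j.+1 w = w.
Proof.
case/orP=> /andP[p q].
- rewrite /dtilde_op (actE (letters_uniq ww) _ p q (a' := j) (b' := j.+1) (c' := j.+2)) //.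
    rewrite -[RHS]map_id; apply: eq_map => x; rewrite /subst3.
    by do ![case: eqP => //].
  by rewrite /dtilde_pat /= !eqseq_cons; do ![case: eqP => //=; try lia].
- rewrite /dtilde_op (actE (letters_uniq ww) _ p q (a' := j.+2) (b' := j.+1) (c' := j)) //.
  + rewrite -[RHS]map_id; apply: eq_map => x; rewrite /subst3.
    by do ![case: eqP => //].
  + by move=> x; rewrite !inE => /or3P[]/eqP->.
  + by rewrite /perm_eq /= ?eqxx; do ![case: eqP => //=; try lia].
  + by rewrite /dtilde_pat /= !eqseq_cons; do ![case: eqP => //=; try lia].
Qed.

Lemma dtilde_rotE a b c a' b' c' : rotation j a b c a' b' c' ->
  prec w a b -> prec w b c -> dtilde_op j.+1 w = map (subst3 a b c a' b' c') w.
Proof.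
by case=> -[-> -> -> -> -> ->] ab bc; apply: actE (letters_uniq ww) _ ab bc _ _;
  rewrite /dtilde_pat /perm_eq /= ?eqseq_cons ?(succ_neq, eqxx) //;
  move=> x; rewrite !inE => /or3P[]/eqP->.
Qed.

Lemma pistol_rows p a b : C a \in pistol delta p -> C b \in pistol delta p ->
  R a = R b \/ (R a = R b + 1)%R /\ ((C b).1 <= (C a).1)%R
    \/ (R b = R a + 1)%R /\ ((C a).1 <= (C b).1)%R.
Proof.
rewrite /R /letter_row -/C !inE; case: (C a) (C b) p => x y [x' y'] [u v] /= h1 h2.
by lia.
Qed.

Section Pistol.
Variable p : int * int.
Hypotheses (h0 : C j \in pistol delta p) (h1 : C j.+1 \in pistol delta p)
  (h2 : C j.+2 \in pistol delta p).

(** Within two rows, [j.+1] must be in the upper one and [j], [j.+2] in the lower one, with [j]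
    strictly left of the cell of [j.+1]. The triple with corner above [j] then contradicts
    [cyc_succ]; [no_132] is analogous, with [j.+1] and [j.+2]. *)
Lemma no_213 : prec w j.+1 j -> prec w j j.+2 -> False.
Proof.
have [_ ->] := prec_succ w0 w1; rewrite prec_letters // /prec_row => p1 p2.
have r01 := pistol_rows h0 h1; have r12 := pistol_rows h1 h2.
have [e l] : (R j.+1 = R j + 1)%R /\ ((C j).1 < (C j.+1).1)%R by lia.
by have := noinv_below w0 w1 e l; rewrite cyc_succ.
Qed.

Lemma no_132 : prec w j j.+2 -> prec w j.+2 j.+1 -> False.
Proof.
have [_ ->] := prec_succ w1 w2; rewrite prec_letters // /prec_row => p1 p2.
have r01 := pistol_rows h0 h1; have r12 := pistol_rows h1 h2.
have [e l] : (R j.+2 = R j.+1 + 1)%R /\ ((C j.+1).1 < (C j.+2).1)%R by lia.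
by have := noinv_below w1 w2 e l; rewrite cyc_succ.
Qed.

Lemma pistol_312 : prec w j.+2 j -> prec w j j.+1 ->
  [/\ R j.+2 = R j, ((C j.+2).1 < (C j).1)%R & below (C j.+2) = C j.+1].
Proof.
have [-> _] := prec_succ w0 w1; rewrite prec_letters // => p1 p2.
have r01 := pistol_rows h0 h1; have r12 := pistol_rows h1 h2.
have r02 := pistol_rows h0 h2.
case: (prec_gap sw) => [[_]|//]; rewrite prec_letters // /prec_row => q.
move: p2; rewrite /prec_row => p2.
have [e [l el]] : (R j.+2 = R j + 1)%R /\ ((C j).1 < (C j.+2).1)%R /\ R j.+1 = R j.
  have e1 : R j.+1 = R j by lia.
  by have l1 := row_succ_left w0 w1 (esym e1); lia.
(* If [j.+2] were alone in the upper row, the entry above [j] would have to be [j.+1], which stands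
   in the row of [j]. *)
have /cyc_gap cy := noinv_below w0 w2 e l.
have [_ cj _] := ext_cell ww cy (ltn0Sn j).
by move: el; rewrite /R /letter_row cj /C /= => el; clear -el; lia.
Qed.

(** If [j.+2] shared the row of [j], then [prec_gap] would put [j.+1] in the row below, although it
    is read first. So only [j] is in the lower row; the pistol bounds its column on the right by
    that of [j.+1], and [cyc_succ] on the left. *)
Lemma pistol_231 : prec w j.+1 j.+2 -> prec w j.+2 j ->
  [/\ R j.+1 = R j.+2, ((C j.+1).1 < (C j.+2).1)%R & below (C j.+1) = C j].
Proof.
have [-> _] := prec_succ w1 w2; rewrite prec_letters // /prec_row => p1 p2.
have r01 := pistol_rows h0 h1; have r12 := pistol_rows h1 h2.
have r02 := pistol_rows h0 h2.
case: (R j.+2 =P R j) => [e|ne].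
  have [[_]|[_ _ b]] := prec_gap sw.
    by rewrite prec_letters // /prec_row; lia.
  have eb : (R j.+1 = R j.+2 - 1)%R by rewrite /R /letter_row -!/(C _) -b.
  by exfalso; lia.
have e1 : R j.+1 = R j.+2 by lia.
have l1 := row_succ_left w1 w2 e1; split=> //.
have e2 : (R j.+1 = R j + 1)%R by lia.
case/orP: (orbN ((C j).1 < (C j.+1).1)%R) => l.
  by have := noinv_below w0 w1 e2 l; rewrite cyc_succ.
have {l} l : (C j).1 = (C j.+1).1 by lia.
move: l e2; rewrite /R /letter_row -/C /below; case: (C j) (C j.+1) => x y [x' y'] /= -> ->.
by rewrite GRing.addrK.
Qed.

End Pistol.

(** Of the six orders of the letters, 123 and 321 are fixed by both operators, 213 and 132 cannot
    occur, and 312 and 231 are rotated around a corner. *)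
Lemma pistoled_step : pistoled delta [seq index x w | x <- [:: j; j.+1; j.+2]] ->
  dtilde_op j.+1 w = w /\ dswap (prec_row R) j.+1 =1 id \/
  exists a b c a' b' c', [/\ rotation j a b c a' b' c', R a = R b,
     ((C a).1 < (C b).1)%R, below (C a) = C c & prec w a b && prec w b c].
Proof.
case/(pistoled_index sw) => p pD [h0 h1 h2].
have n01 : j != j.+1 by lia.
have n12 : j.+1 != j.+2 by lia.
have n02 : j != j.+2 by lia.
case/orP: (prec_total w0 w1 n01) => p1; case/orP: (prec_total w1 w2 n12) => p2.
- left; split; first by apply: dtilde_idE; rewrite p1 p2.
  move: p1 p2; have [-> _] := prec_succ w0 w1; have [-> _] := prec_succ w1 w2.
  rewrite /dswap /between /prec_row /= => p1 p2.
  by do 2![case: ifP => [?|_]; first by exfalso; lia].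
- case/orP: (prec_total w0 w2 n02) => p3; first by case: (no_132 h0 h1 h2 p3 p2).
  right; exists j.+2, j, j.+1, j.+1, j.+2, j; rewrite p3 p1.
  by have [] := pistol_312 h0 h1 h2 p3 p1; split=> //; left.
- case/orP: (prec_total w0 w2 n02) => p3; first by case: (no_213 h0 h1 h2 p1 p3).
  right; exists j.+1, j.+2, j, j.+2, j, j.+1; rewrite p2 p3.
  by have [] := pistol_231 h0 h1 h2 p2 p3; split=> //; right.
- left; split; first by apply: dtilde_idE; rewrite p1 p2 orbT.
  move: p1 p2; have [_ ->] := prec_succ w0 w1; have [_ ->] := prec_succ w1 w2.
  rewrite /dswap /between /prec_row /= => p1 p2.
  by do 2![case: ifP => [?|_]; first by exfalso; lia].
Qed.

(** Used contrapositively: d_i exchanges the two outer letters, so a pistol containing both would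
    contain the middle one and make all three pistoled. *)
Lemma swap_apart r k m : C k \in pistol delta r -> C k.+1 \in pistol delta r ->
  k \in w -> k.+1 \in w -> m \in w -> between (prec w) k m k.+1 -> C m \in pistol delta r.
Proof.
move=> hk hk1 kw k1w mw; rewrite /between !(prec_cell ww) //.
by case/orP=> /andP[l1 l2]; 
  [apply: pistol_interval hk hk1 l1 l2 | apply: pistol_interval hk1 hk l1 l2];
  apply: (cell_in ww).
Qed.

Lemma nonpistoled_step : ~~ pistoled delta [seq index x w | x <- [:: j; j.+1; j.+2]] ->
  let g := dswap (prec_row R) j.+1 in
  [/\ d_op j.+1 w = map g w, noinv delta (filling delta (map g w))
    & descents delta (filling delta (map g w)) = descents delta (filling delta w)].
Proof.
move=> np.
have {}np r : r \in delta ->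
    ~ [/\ C j \in pistol delta r, C j.+1 \in pistol delta r & C j.+2 \in pistol delta r].
  by move=> rD h; apply: (negP np); apply/(pistoled_index sw); exists r.
have <- : dswap (prec w) j.+1 = dswap (prec_row R) j.+1.
  have [e1 e2] := prec_succ w0 w1; have [e3 e4] := prec_succ w1 w2.
  have [e5 e6] : prec w j j.+2 = prec_row R j j.+2 /\ prec w j.+2 j = prec_row R j.+2 j.
    (* The exceptional case of [prec_gap] is pistoled: the three cells lie in the pistol starting at
       the cell of [j.+2]. *)
    case: (prec_gap sw) => // -[r lt b]; case: (np (C j.+2)); first exact: (cell_in ww w2).
    have D z : z \in w -> C z \in delta := @cell_in _ _ ww z.
    rewrite !inE !D //=; move: r lt b; rewrite /R /letter_row -!/(C _).
    case: (C j) (C j.+1) (C j.+2) => x y [x1 y1] [x2 y2] /= r lt [b1 b2].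
    by clear -r lt b1 b2; split; lia.
  have e x : prec w x x = prec_row R x x.
    by rewrite /prec /prec_row !ltnn andbF orbF Order.POrderTheory.ltxx.
  apply: eq_dswap => x y; rewrite !inE /= => /or3P[]/eqP-> /or3P[]/eqP->; rewrite ?e //.
have jpos : 0 < j by move: w0; rewrite (mem_word ww) => /andP[].
rewrite /= d_opE ?(letters_uniq ww) //; rewrite /dswap /=.
case: ifP => b1; last case: ifP => b2; last by rewrite map_id.
- have ap r : r \in delta ->
      ~~ ((cell delta w j.+1 \in pistol delta r) && (cell delta w j.+2 \in pistol delta r)).
    move=> rD; apply/negP => /andP[h1 h2]; apply: (np r rD).
    by split=> //; apply: (swap_apart h1 h2).
  by split=> //; [apply: noinv_swap|apply: descents_swap].
- have ap r : r \in delta ->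
      ~~ ((cell delta w j \in pistol delta r) && (cell delta w j.+1 \in pistol delta r)).
    move=> rD; apply/negP => /andP[h1 h2]; apply: (np r rD).
    by split=> //; apply: (swap_apart h1 h2).
  by split=> //; [apply: noinv_swap|apply: descents_swap].
Qed.

Lemma rotation_inj a b c a' b' c' : rotation j a b c a' b' c' ->
  injective (subst3 a b c a' b' c').
Proof.
by case=> -[-> -> -> -> -> ->] x y; rewrite /subst3; do ![case: eqP => ?]; lia.
Qed.

Lemma rotationK a b c a' b' c' : rotation j a b c a' b' c' ->
  cancel (subst3 a' b' c' a b c) (subst3 a b c a' b' c').
Proof.
case=> -[-> -> -> -> -> ->] x; rewrite /subst3;
  case: (eqVneq x j) => [->|/negPf n0]; rewrite ?eqxx ?succ_neq ?eqxx //;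
  case: (eqVneq x j.+1) => [->|/negPf n1]; rewrite ?eqxx ?succ_neq ?eqxx //;
  case: (eqVneq x j.+2) => [->|/negPf n2]; rewrite ?eqxx ?succ_neq ?eqxx //;
  by rewrite ?n0 ?n1 ?n2.
Qed.

Lemma dswap_in rho : {in w, forall x, dswap (prec_row rho) j.+1 x \in w}.
Proof.
move=> x xw; rewrite /dswap; case: ifP => _; last case: ifP => _ //;
 by rewrite /swap; case: ifP => _ //; case: ifP.
Qed.

Lemma rotation_in a b c a' b' c' : rotation j a b c a' b' c' ->
  {in w, forall x, subst3 a b c a' b' c' x \in w}.
Proof.
by case=> -[-> -> -> -> -> ->] x xw; rewrite /subst3; do ![case: eqP => // ?].
Qed.

(** The last clause is the one that removes pistols from the problem: in both cases of D_i the row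
    function changes by the same rule. *)
Lemma D_step : exists g,
  [/\ perm_eq (map g w) (iota 1 #|` delta|), D_op delta j.+1 w = map g w,
      noinv delta (filling delta (map g w)),
      descents delta (filling delta (map g w)) = descents delta (filling delta w)
    & letter_row delta (map g w) =1 R \o dswap (prec_row R) j.+1].
Proof.
have gi := can_inj (dswapK (prec_row R) j.+1).
have jpos : 0 < j by move: w0; rewrite (mem_word ww) => /andP[].
have G x : letter_row delta (map (dswap (prec_row R) j.+1) w) x = R (dswap (prec_row R) j.+1 x).
  by rewrite -{1}[x](dswapK (prec_row R) j.+1) /letter_row cell_map.
rewrite /D_op; case: ifP => [|/negbT] p; last first.
  exists (dswap (prec_row R) j.+1); have [-> ? ?] := nonpistoled_step p.
  by split=> //; apply: (map_letters ww) => //; apply: dswap_in.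
have [[-> e]|[a [b [c [a' [b' [c' [rot rab lab bac /andP[pab pbc]]]]]]]]] := pistoled_step p.
  by exists id; rewrite map_id; split=> // x; rewrite /= e.
exists (subst3 a b c a' b' c').
have sabc : {subset [:: a; b; c] <= w}.
  by case: rot => -[-> -> -> _ _ _] x; rewrite !inE => /or3P[]/eqP->.
split; first by apply: (map_letters ww) (rotation_inj rot) (rotation_in rot).
- exact: dtilde_rotE rot pab pbc.
- exact: noinv_rot rot sabc rab lab bac NI.
- exact: descents_rot rot sabc rab lab bac.
move=> x; rewrite -{1}[x](rotationK rot) /letter_row cell_map; last exact: rotation_inj rot.
have rbc : (R b = R c + 1)%R.
  have <- : R a = R b by [].
  by rewrite /R /letter_row -/C; have := congr1 snd bac; rewrite -/C /= => <-;
    rewrite GRing.subrK.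
(* With [a] and [b] in one row and [c] in the row below, [j.+2] comes between [j] and [j.+1] in the
   row order, for both patterns. *)
rewrite -/(R _) /=; have -> : dswap (prec_row R) j.+1 = swap j j.+1.
  rewrite /dswap.
  have -> : between (prec_row R) j.+1 j.+1.-1 j.+2 = false.
    by case: rot rab rbc => -[-> -> -> _ _ _];
      rewrite /between /prec_row /R /= => r1 r2; clear -r1 r2; lia.
  have -> // : between (prec_row R) j.+1.-1 j.+2 j.+1.
    by case: rot rab rbc => -[-> -> -> _ _ _];
      rewrite /between /prec_row /R /= => r1 r2; clear -r1 r2; lia.
(* The inverse rotation and the exchange differ as permutations, but have the same effect on rows
   because [a] and [b] share theirs. *)
case: rot rab rbc => -[-> -> -> -> -> ->] rab _; rewrite /subst3 /swap.
- case: (eqVneq x j) => [?|/negPf n0]; last case: (eqVneq x j.+1) => [?|/negPf n1];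
    last case: (eqVneq x j.+2) => [?|/negPf n2];
      by subst; rewrite ?eqxx ?succ_neq ?eqxx ?n0 ?n1 ?n2.
- case: (eqVneq x j) => [?|/negPf n0]; last case: (eqVneq x j.+1) => [?|/negPf n1];
    last case: (eqVneq x j.+2) => [?|/negPf n2];
      by subst; rewrite ?eqxx ?succ_neq ?eqxx ?n0 ?n1 ?n2.
Qed.

End Triple.

End Step.

(** * The row function *)

Lemma cyc_anti a b c : cyc a b c -> cyc b a c = false.
Proof. by rewrite /cyc; lia. Qed.

(** At a first cell where the fillings differ, each of the two entries occurs in the other filling
    further right in the same row. This gives both cyclic orders of the two entries with the common
    entry below, a contradiction. *)
Lemma noinv_row_inj delta w w' :
  perm_eq w (iota 1 #|` delta|) -> perm_eq w' (iota 1 #|` delta|) ->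
  noinv delta (filling delta w) -> noinv delta (filling delta w') ->
  {in w, letter_row delta w =1 letter_row delta w'} -> w = w'.
Proof.
move=> ww ww' NI NI' rE; rewrite (word_filling ww) (word_filling ww').
(* The induction goes through the rows from the bottom up, each from left to right, so that the
   entry below is settled first. *)
pose before (c b : int * int) := ((b.2 < c.2) || (b.2 == c.2) && (b.1 < c.1))%R.
suff eq_fill m c : c \in delta -> count (before c) (cells delta) < m ->
    filling delta w c = filling delta w' c.
  by apply/eq_in_map => c; rewrite mem_cells => cD; apply: eq_fill cD (ltnSn _).
have mw z : (z \in w) = (z \in w') by rewrite !(mem_word (delta := delta)).
elim: m c => // m IH c cD; rewrite ltnS => cm.
have {}IH b : b \in delta -> before c b -> filling delta w b = filling delta w' b.
  move=> bD bc; apply: IH => //; apply: leq_trans cm.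
  have sub : subpred (before b) (before c).
    by move: bc; case: b {bD} c {cD} => x y [x' y'] h [u v]; move: h; rewrite /before /=; lia.
  rewrite -!size_filter; apply: (@leq_trans (size (b :: filter (before b) (cells delta)))) => //.
  apply: uniq_leq_size.
    rewrite /= filter_uniq ?cells_uniq // mem_filter /before.
    by rewrite !Order.POrderTheory.ltxx andbF.
  move=> x; rewrite inE mem_filter => /orP[/eqP->|/andP[/sub bx xC]].
    by rewrite mem_filter bc mem_cells.
  by rewrite mem_filter bx.
have below_eq : ext delta (filling delta w) (below c) = ext delta (filling delta w') (below c).
  rewrite /ext; case: ifP => // eD; apply: IH => //.
  by case: (c) => x y; rewrite /before /=; lia.
have key v v' : perm_eq v (iota 1 #|` delta|) -> perm_eq v' (iota 1 #|` delta|) ->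
    noinv delta (filling delta v) -> 
    (forall b, b \in delta -> before c b -> filling delta v b = filling delta v' b) ->
    {in v, letter_row delta v =1 letter_row delta v'} -> v =i v' ->
    filling delta v c != filling delta v' c ->
    cyc (filling delta v c) (filling delta v' c) (ext delta (filling delta v) (below c)).
  move=> vv vv' NIv E rEv mv ne; pose d := cell delta v (filling delta v' c).
  have zv : filling delta v' c \in v by rewrite mv (filling_mem vv').
  have dD : d \in delta := cell_in vv zv.
  have fd : filling delta v d = filling delta v' c := filling_cell vv zv.
  have e2 : c.2 = d.2.
    by have := rEv _ zv; rewrite /letter_row -/d (cell_filling vv') // => ->.
  have lt : (c.1 < d.1)%R.
    (* At an earlier cell the fillings agree, so [v'] would have the same entry at [d] and at
       [c]. *)
    have nlt : ~~ before c d.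
      apply/negP => bd; move: fd; rewrite (E _ dD bd) => /(filling_inj vv' dD cD) dc.
      by move: bd; rewrite dc /before !Order.POrderTheory.ltxx andbF.
    have ncd : c != d by apply: contra ne => /eqP {1}->; rewrite fd.
    by move: e2 nlt ncd; rewrite /before; case: (c) (d) => x y [x' y'] /= ->;
      rewrite xpair_eqE; lia.
  by have := NIv c d dD e2 lt; rewrite cD {1 2}/ext cD dD fd => /(_ isT).
apply/eqP; apply/negPn/negP => ne.
have k1 := key _ _ ww ww' NI IH rE mw ne.
have k2 : cyc (filling delta w' c) (filling delta w c) (ext delta (filling delta w') (below c)).
  apply: key ww' ww NI' _ _ _ _ => //; last by rewrite eq_sym.
  - by move=> b bD bc; rewrite IH.
  - by move=> z; rewrite -mw => /rE.
by move: k2; rewrite -below_eq (cyc_anti k1).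
Qed.

Definition le_row (rho : nat -> int) (a b : nat) : bool :=
  ((rho b < rho a) || ((rho a == rho b) && (a <= b)%N))%R.

Definition row_word (k : nat) (rho : nat -> int) : seq nat := sort (le_row rho) (iota 1 k).

Lemma le_row_total rho : total (le_row rho).
Proof. by move=> a b; rewrite /le_row; lia. Qed.

Lemma le_row_trans rho : transitive (le_row rho).
Proof. by move=> a b c; rewrite /le_row; lia. Qed.

Lemma le_row_anti rho : antisymmetric (le_row rho).
Proof. by move=> a b; rewrite /le_row; lia. Qed.

Lemma perm_row_word k rho : perm_eq (row_word k rho) (iota 1 k).
Proof. by rewrite perm_sort. Qed.

Lemma prec_row_word k rho : {in iota 1 k &, prec (row_word k rho) =2 prec_row rho}.
Proof.
move=> a b; rewrite -!(perm_mem (perm_row_word k rho)) => aw bw.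
have so : sorted (le_row rho) (row_word k rho) := sort_sorted (le_row_total rho) _.
have le := sorted_ltn_index (@le_row_trans rho) so.
rewrite /prec; case: ltngtP => h.
- have ne : a != b by apply: contraTN h => /eqP->; rewrite ltnn.
  by move: (le _ _ aw bw h) ne; rewrite /le_row /prec_row; lia.
- by move: (le _ _ bw aw h); rewrite /le_row /prec_row; lia.
- by rewrite (index_inj 0 aw bw h) /prec_row ltnn andbF Order.POrderTheory.ltxx.
Qed.

(** The two exchanged letters lie in different rows, since the third comes between them in the row
    order. As they are consecutive, their exchange keeps the order of the letters within every
    row. *)
Lemma row_word_dswap k rho rho' i : 2 <= i < k ->
  rho' =1 rho \o dswap (prec_row rho) i ->
  row_word k rho' = map (dswap (prec_row rho) i) (row_word k rho).
Proof.
move=> /andP[i2 ik] e; set g := dswap _ _.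
have gK : involutive g := dswapK _ _.
have gi : {in iota 1 k, forall x, g x \in iota 1 k}.
  move=> x; rewrite /g /dswap /swap !mem_iota => xk.
  by do ![case: ifP => _ //]; lia.
apply: (sorted_eq (@le_row_trans rho') (@le_row_anti rho')).
- exact: sort_sorted (le_row_total _) _.
- rewrite sorted_map; apply: sub_sorted (sort_sorted (le_row_total rho) _) => a b /=.
  rewrite /le_row !e /= -/g !gK => /orP[->//|/andP[ab le]]; rewrite ab /=.
  rewrite orbC; apply/orP; left; move: ab le; rewrite /g /dswap /between /prec_row.
  by case: ifP => [h|_]; last case: ifP => [h|//]; rewrite /swap => /eqP ab le;
    do ![case: eqP => [?|?]]; subst; lia.
- rewrite perm_sym; apply: (perm_trans _ (_ : perm_eq (iota 1 k) _));
    last by rewrite perm_sym perm_sort.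
  apply: (map_letters (perm_row_word k rho) (inv_inj gK)) => x.
  by rewrite !(perm_mem (perm_row_word k rho)); apply: gi.
Qed.

Lemma d_op_row_word k rho i : 2 <= i < k ->
  d_op i (row_word k rho) = map (dswap (prec_row rho) i) (row_word k rho).
Proof.
move=> /andP[i2 ik]; have sub : {subset [:: i.-1; i; i.+1] <= iota 1 k}.
  by move=> x; rewrite !inE mem_iota => /or3P[]/eqP->; lia.
rewrite d_opE; first last.
- by move=> x xs; rewrite (perm_mem (perm_row_word k rho)); apply: sub.
- by rewrite sort_uniq iota_uniq.
- by lia.
by congr map; apply: eq_dswap => a b /sub aI /sub bI; apply: prec_row_word.
Qed.

(** Allows the letters of an interval to be renumbered from 1. *)
Lemma dswap_shift b rho i x : 0 < i ->
  (dswap (prec_row rho) (b + i) (b + x) = b + dswap (prec_row (rho \o addn b)) i x)%N.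
Proof.
case: i => // i _; have P a c : prec_row rho (b + a)%N (b + c)%N = prec_row (rho \o addn b) a c.
  by rewrite /prec_row ltn_add2l.
have S y z : (swap (b + y) (b + z) (b + x) = b + swap y z x)%N.
  by rewrite /swap !eqn_add2l; do 2![case: ifP => // _].
by rewrite /dswap /between addnS /= -!addnS !P; case: ifP => _; last case: ifP => _;
  rewrite ?S.
Qed.

(** * Words with at most six letters *)

(** Schensted row insertion; the optional letter is the one bumped into the next row. *)
Fixpoint row_insert (x : nat) (r : seq nat) : seq nat * option nat :=
  if r is y :: r' then
    if x < y then (x :: r', Some y)
    else let: (r'', o) := row_insert x r' in (y :: r'', o)
  else ([:: x], None).

Fixpoint tableau_insert (t : seq (seq nat)) (x : nat) : seq (seq nat) :=
  if t is r :: t' then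
    let: (r', o) := row_insert x r in
    r' :: (if o is Some y then tableau_insert t' y else t')
  else [:: [:: x]].

Definition insertion_tableau : seq nat -> seq (seq nat) := foldl tableau_insert [::].

(* The recording tableau, given as the chain of shapes it encodes. *)
Definition recording (w : seq nat) : seq (seq nat) :=
  [seq shape t | t <- scanl tableau_insert [::] w].

Definition tableau_word (w : seq nat) : seq nat := flatten (rev (insertion_tableau w)).
Definition tableau_shape (w : seq nat) : seq nat := shape (insertion_tableau w).

(** A version over natural numbers, in reading order, on which the finite checks compute;
    [cells_young] relates it to [cells]. *)
Definition young_cells (la : seq nat) : seq (nat * nat) :=
  [seq (x, y) | y <- rev (iota 0 (size la)), x <- iota 0 (nth 0 la y)].

Definition standard_word (la w : seq nat) : bool :=
  let cs := zip (young_cells la) w in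
  all (fun c => all (fun d =>
      ((c.1.2 == d.1.2) && (c.1.1 < d.1.1) ==> (c.2 < d.2))
      && ((c.1.1 == d.1.1) && (c.1.2 < d.1.2) ==> (c.2 < d.2))) cs) cs.

Definition words (k : nat) : seq (seq nat) := permutations (iota 1 k).

(** Passing to the insertion tableau keeps the signature and commutes with each d_i, while d_i
    leaves the recording tableau unchanged. *)
Definition insertion_check (k : nat) (w : seq nat) : bool :=
  let la := tableau_shape w in let r := tableau_word w in
  [&& is_partition la, sumn la == k, perm_eq r (iota 1 k), standard_word la r,
   all (fun i => prec r i i.+1 == prec w i i.+1) (iota 1 k.-1) &
   all (fun i => let w' := d_op i w in
     [&& tableau_word w' == d_op i r, tableau_shape w' == la & recording w' == recording w])
     (iota 2 k.-2)].

Definition expand (k : nat) (s : seq (seq nat)) : seq (seq nat) :=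
  undup (s ++ [seq d_op i w | i <- iota 2 k.-2, w <- s]).

(* Eight rounds exhaust every standard tableau graph with at most six cells. *)
Definition connected_check (k : nat) (la : seq nat) : bool :=
  let rs := [seq r <- words k | standard_word la r] in
  all (fun r => let s := iter 8 (expand k) [:: r] in all (mem s) rs) rs.

Lemma insertion_checked : all (fun k => all (insertion_check k) (words k)) (iota 1 6).
Proof. by vm_compute. Qed.

Lemma connected_checked :
  all (fun k => all (connected_check k) (undup (map tableau_shape (words k)))) (iota 1 6).
Proof. by vm_compute. Qed.

Lemma rsk_checked :
  all (fun k => uniq [seq (tableau_word w, recording w) | w <- words k]) (iota 1 6).
Proof. by vm_compute. Qed.

Lemma uniq_map_inj (S T : eqType) (f : S -> T) (s : seq S) :
  uniq (map f s) -> {in s &, injective f}.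
Proof.
move=> us x y xs ys e; apply: (index_inj x xs ys); apply/eqP.
rewrite -(nth_uniq (f x) _ _ us) ?size_map ?index_mem //.
by rewrite !(nth_map x) ?index_mem // !nth_index // e.
Qed.

Section SmallWords.
Variable k : nat.
Hypothesis k6 : 0 < k <= 6.

Let kI : k \in iota 1 6. Proof. by rewrite mem_iota. Qed.

Lemma mem_words w : (w \in words k) = perm_eq w (iota 1 k).
Proof. by rewrite mem_permutations. Qed.

Section Insertion.
Variable w : seq nat.
Hypothesis ww : perm_eq w (iota 1 k).

Let checked : insertion_check k w.
Proof. by apply: (allP (allP insertion_checked _ kI)); rewrite mem_words. Qed.

Lemma tableau_shape_partition : is_partition (tableau_shape w).
Proof. by have /and5P[] := checked. Qed.

Lemma sumn_tableau_shape : sumn (tableau_shape w) = k.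
Proof. by have /and5P[_ /eqP] := checked. Qed.

Lemma perm_tableau_word : perm_eq (tableau_word w) (iota 1 k).
Proof. by have /and5P[] := checked. Qed.

Lemma standard_tableau_word : standard_word (tableau_shape w) (tableau_word w).
Proof. by have /and5P[] := checked. Qed.

Lemma prec_tableau_word i : 1 <= i < k -> prec (tableau_word w) i i.+1 = prec w i i.+1.
Proof.
move=> ik; have /and5P[_ _ _ _ /andP[/allP h _]] := checked.
have ii : i \in iota 1 k.-1 by rewrite mem_iota; lia.
exact: (eqP (h i ii)).
Qed.

Lemma tableau_d_op i : 2 <= i < k ->
  [/\ tableau_word (d_op i w) = d_op i (tableau_word w),
      tableau_shape (d_op i w) = tableau_shape w & recording (d_op i w) = recording w].
Proof.
move=> ik; have /and5P[_ _ _ _ /andP[_ /allP h]] := checked.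
have ii : i \in iota 2 k.-2 by rewrite mem_iota; lia.
by have /and3P[/eqP-> /eqP-> /eqP->] := h i ii.
Qed.

End Insertion.

Lemma tableau_word_inj w w' : perm_eq w (iota 1 k) -> perm_eq w' (iota 1 k) ->
  tableau_word w = tableau_word w' -> recording w = recording w' -> w = w'.
Proof.
rewrite -!mem_words => ww ww' e1 e2; have := allP rsk_checked _ kI.
by move/uniq_map_inj/(_ _ _ ww ww'); apply; rewrite e1 e2.
Qed.

(** Connectedness of the tableau graph as an induction principle; [w] witnesses that its shape is
    among those checked. *)
Lemma standard_connected (Q : seq nat -> Prop) w r r' : perm_eq w (iota 1 k) ->
  perm_eq r (iota 1 k) -> perm_eq r' (iota 1 k) ->
  standard_word (tableau_shape w) r -> standard_word (tableau_shape w) r' ->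
  (forall s i, 2 <= i < k -> Q s -> Q (d_op i s)) -> Q r -> Q r'.
Proof.
rewrite -!mem_words => ww rw rw' sr sr' cl Qr.
have cS m : {in iter m (expand k) [:: r], forall s, Q s}.
  elim: m => [|m IH] s /=; first by rewrite inE => /eqP->.
  rewrite mem_undup mem_cat => /orP[/IH//|/allpairsP[[i u] /= [ik us ->]]].
  by apply: cl; [move: ik; rewrite mem_iota; lia|apply: IH].
apply: (cS 8).
have shI : tableau_shape w \in undup (map tableau_shape (words k)).
  by rewrite mem_undup map_f.
have /allP/(_ r) := allP (allP connected_checked _ kI) _ shI.
rewrite mem_filter sr rw => /(_ isT)/allP/(_ r').
by rewrite mem_filter sr' rw' => /(_ isT).
Qed.

End SmallWords.

(** * Young diagrams as lists of cells *)

Definition int_cell (c : nat * nat) : int * int := (Posz c.1, Posz c.2).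

Lemma int_cell_inj : injective int_cell.
Proof. by case=> a b [c d] [-> ->]. Qed.

Lemma size_young_cells la : size (young_cells la) = sumn la.
Proof.
rewrite size_allpairs_dep map_rev sumn_rev -[in RHS](mkseq_nth 0 la).
by congr sumn; apply: eq_map => y; rewrite size_iota.
Qed.

Lemma young_cells_sorted la : pairwise (relpre int_cell reading_lt) (young_cells la).
Proof.
rewrite /young_cells; elim: (size la) => // m IH.
rewrite -addn1 iotaD rev_cat /= pairwise_cat IH andbT; apply/andP; split.
  apply/allrelP => c d /mapP[x _ ->] /allpairsPdep[y [x' [ym _ ->]]].
  by move: ym; rewrite mem_rev mem_iota /reading_lt /=; lia.
rewrite add0n pairwise_map -sorted_pairwise; last first.
  by move=> a b c; rewrite /= /reading_lt /=; lia.
by apply: sub_sorted (iota_ltn_sorted _ _) => a b /=; rewrite /reading_lt /=; lia.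
Qed.

Lemma reading_lt_irr : irreflexive reading_lt.
Proof. by case=> x y; rewrite /reading_lt /=; lia. Qed.

Lemma young_cells_uniq la : uniq (young_cells la).
Proof.
apply: (@pairwise_uniq _ (relpre int_cell reading_lt)) (young_cells_sorted la).
by move=> c; apply: reading_lt_irr.
Qed.

Lemma cells_young la : cells (young_diagram la) = map int_cell (young_cells la).
Proof.
apply: (sorted_eq reading_le_trans).
- by case=> x y [x' y']; rewrite /reading_le /= => h; congr pair; lia.
- exact: cells_sorted.
- rewrite sorted_map; apply: (pairwise_sorted (e := relpre int_cell reading_le)).
  apply: sub_pairwise (young_cells_sorted la) => -[x y] [x' y'].
  by rewrite /reading_lt /reading_le /=; lia.
- apply: uniq_perm; rewrite ?cells_uniq ?(map_inj_uniq int_cell_inj) ?young_cells_uniq //.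
  move=> c; rewrite mem_cells /young_diagram !inE /=.
  apply/allpairsPdep/mapP => [[y [x [yl xl ->]]]|[[x y] cl ->]].
    by exists (x, y) => //; apply/allpairsPdep; exists y, x; rewrite mem_rev.
  move/allpairsPdep: cl => [y' [x' [yl xl [-> ->]]]].
  by exists y', x'; rewrite mem_rev in yl.
Qed.

Lemma standard_fillingE la w : size w = sumn la ->
  standard_filling (young_diagram la) (filling (young_diagram la) w) = standard_word la w.
Proof.
move=> sw; rewrite /standard_filling /standard_word cells_young.
set T := filling _ _.
have TE p : T (int_cell p) = nth 0 w (index p (young_cells la)).
  by rewrite /T /filling cells_young index_map //; apply: int_cell_inj.
have -> : zip (young_cells la) w = [seq (p, T (int_cell p)) | p <- young_cells la].
  apply: (@eq_from_nth _ ((0, 0), 0)).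
    by rewrite size_zip size_map sw size_young_cells minnn.
  move=> i; rewrite size_zip sw size_young_cells minnn => il.
  rewrite nth_zip ?sw ?size_young_cells // (nth_map (0, 0)) ?size_young_cells //.
  by rewrite TE index_uniq ?young_cells_uniq ?size_young_cells.
rewrite !all_map; apply: eq_all => -[x y] /=; rewrite !all_map.
by apply: eq_all => -[x' y'] /=.
Qed.

(** * Permutations and their one-line words *)

Lemma perm_word n (p : 'S_n) : perm_eq (word p) (iota 1 n).
Proof.
have uw : uniq (word p).
  by rewrite map_inj_uniq ?enum_uniq // => a b [] /val_inj /perm_inj.
apply: uniq_perm; rewrite ?iota_uniq //; apply: (uniq_min_size uw _ _).2.
  by move=> x /mapP[k _ ->]; rewrite mem_iota add1n !ltnS; apply: ltn_ord.
by rewrite size_iota size_map size_enum_ord.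
Qed.

Lemma word_inj n : injective (@word n).
Proof.
have nthE (p : 'S_n) (k : 'I_n) : nth 0 (word p) k = (p k).+1.
  by rewrite (nth_map k) ?size_enum_ord // nth_ord_enum.
by move=> p q e; apply/permP => k; apply/val_inj/succn_inj; rewrite -!nthE e.
Qed.

Lemma word_surj n w : perm_eq w (iota 1 n) -> exists p : 'S_n, word p = w.
Proof.
move=> ww.
have sw : size w = n by rewrite (perm_size ww) size_iota.
have uw : uniq w by rewrite (perm_uniq ww) iota_uniq.
have mw x : (x \in w) = (0 < x <= n) by rewrite (perm_mem ww) mem_iota add1n ltnS.
have wk (k : 'I_n) : 0 < nth 0 w k <= n by rewrite -mw mem_nth ?sw.
pose f (k : 'I_n) : 'I_n := insubd k (nth 0 w k).-1.
have fE k : (f k).+1 = nth 0 w k.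
  by rewrite val_insubd; move: (wk k); case: ifP; lia.
have fi : injective f.
  move=> a b /(congr1 (fun k : 'I_n => k.+1)) /=; rewrite !fE => /eqP.
  by rewrite nth_uniq ?sw // => /eqP /val_inj.
exists (perm fi); apply: (@eq_from_nth _ 0); rewrite /word size_map size_enum_ord ?sw //.
move=> i il; rewrite (nth_map (Ordinal il)) ?size_enum_ord // permE fE.
by rewrite nth_enum_ord.
Qed.

(** * Graphs *)

Lemma set2_eq (T : finType) (a b c d : T) :
  [set a; b] = [set c; d] -> a = c /\ b = d \/ a = d /\ b = c.
Proof.
move=> e.
have := set21 a b; rewrite e !inE => /orP[]/eqP ac; have := set22 a b;
  rewrite e !inE => /orP[]/eqP bd; subst; auto.
  by have := set22 c d; rewrite -e !inE => /orP[]/eqP ->; auto.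
by have := set21 c d; rewrite -e !inE => /orP[]/eqP ->; auto.
Qed.

Lemma induced_edge n op (A : pred 'S_n) i (v u : {p | A p}) :
  ([set v; u] \in edges (@induced (word_graph n op) A) i) =
  (v != u) && ((word (val u) == op i (word (val v))) || (word (val v) == op i (word (val u)))).
Proof.
rewrite inE /= imsetU1 imset_set1 -(inj_eq val_inj).
apply/imsetP/andP => [[[p q]]|[vu]].
  rewrite inE /= => /andP[e pq] /set2_eq[] [-> ->]; rewrite e ?orbT //.
  by rewrite eq_sym.
case/orP=> e; first by exists (val v, val u); rewrite // inE /= e eq_sym vu.
by exists (val u, val v); [rewrite inE /= e vu | rewrite setUC].
Qed.

(** The exchange of the two outer letters leaves the same letter in the middle, so the same exchange
    is chosen again. This makes the step on row functions symmetric. *)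
Lemma dswap_prec_row_comp rho i : 0 < i ->
  dswap (prec_row (rho \o dswap (prec_row rho) i)) i = dswap (prec_row rho) i.
Proof.
case: i => // i _; set g := dswap (prec_row rho) i.+1.
have [[b e]|[[nb b e]|[nb nb' e]]] :
    between (prec_row rho) i.+1 i i.+2 /\ g = swap i.+1 i.+2 \/
    ([/\ between (prec_row rho) i.+1 i i.+2 = false,
         between (prec_row rho) i i.+2 i.+1 & g = swap i i.+1] \/
    [/\ between (prec_row rho) i.+1 i i.+2 = false,
        between (prec_row rho) i i.+2 i.+1 = false & g = id]).
- rewrite /g /dswap /=; case: ifP => b1; first by left.
  by case: ifP => b2; right; [left|right].
- rewrite e /dswap /=.
  have -> // : between (prec_row (rho \o swap i.+1 i.+2)) i.+1 i i.+2.
  clear e g; move: b; rewrite /between /prec_row /= /swap !(succ_neq, eqxx); lia.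
- rewrite e /dswap /=.
  have -> : between (prec_row (rho \o swap i i.+1)) i.+1 i i.+2 = false.
    by clear e g; move: b; rewrite /between /prec_row /= /swap !(succ_neq, eqxx); lia.
  have -> // : between (prec_row (rho \o swap i i.+1)) i i.+2 i.+1.
  by clear e g; move: b; rewrite /between /prec_row /= /swap !(succ_neq, eqxx); lia.
- by rewrite e -[RHS]e /g.
Qed.

Lemma dswap_out pr i x : x \notin [:: i.-1; i; i.+1] -> dswap pr i x = x.
Proof.
rewrite !inE !negb_or => /and3P[/negPf n1 /negPf n2 /negPf n3].
by rewrite /dswap; case: ifP => _; last case: ifP => _ //; rewrite /swap ?n1 ?n2 ?n3.
Qed.

Lemma dswap_mem pr i x :
  (dswap pr i x \in [:: i.-1; i; i.+1]) = (x \in [:: i.-1; i; i.+1]).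
Proof.
suff h y : y \in [:: i.-1; i; i.+1] -> dswap pr i y \in [:: i.-1; i; i.+1].
  by apply/idP/idP => [/h|/h //]; rewrite dswapK.
move=> yi; rewrite /dswap; case: ifP => _; last case: ifP => _ //;
  by rewrite /swap; do 2?[case: ifP => // _]; rewrite !inE eqxx ?orbT.
Qed.

Lemma dswap_comm pr pr' i j : (i + 2 < j) || (j + 2 < i) -> 0 < i -> 0 < j ->
  dswap pr i \o dswap pr' j =1 dswap pr' j \o dswap pr i.
Proof.
move=> ij i0 j0 x /=.
have dis y : y \in [:: i.-1; i; i.+1] -> y \notin [:: j.-1; j; j.+1].
  by rewrite !inE; lia.
have [xi|xi] := boolP (x \in [:: i.-1; i; i.+1]).
  by rewrite ![dswap pr' j _]dswap_out // dis // dswap_mem.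
rewrite [dswap pr i x]dswap_out //.
have [xj|xj] := boolP (x \in [:: j.-1; j; j.+1]).
  by rewrite dswap_out //; apply/negP => /dis; rewrite dswap_mem xj.
by rewrite [dswap pr' j x]dswap_out // dswap_out.
Qed.

Lemma eq_dswap_prec_row rho rho' i : {in [:: i.-1; i; i.+1], rho =1 rho'} ->
  dswap (prec_row rho) i = dswap (prec_row rho') i.
Proof. by move=> e; apply: eq_dswap => a b ai bi; rewrite /prec_row !e. Qed.

(** * Induced subgraphs on closed sets of inversion-free words *)

Section Graph.
Variables (delta : diagram) (A : pred 'S_#|` delta|).
Local Notation n := #|` delta|.
Hypothesis A_noinv : forall p, A p -> noinv delta (filling delta (word p)).
Hypothesis A_closed : forall p q, A p -> noinv delta (filling delta (word q)) ->
  descents delta (filling delta (word q)) = descents delta (filling delta (word p)) -> A q.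

Local Notation V := {p : 'S_n | A p}.
Local Notation G := (@induced (assaf_graph delta) A).

Let W (v : V) := word (val v).
Let R (v : V) := letter_row delta (W v).

(** The i-step in terms of row functions alone, fixed points included; [nextP] identifies it with
    D_i. *)
Definition next (i : nat) (v u : V) : Prop := R u =1 R v \o dswap (prec_row (R v)) i.

Lemma row_inj v u : R v =1 R u -> v = u.
Proof.
move=> e; apply/val_inj/word_inj.
exact: (noinv_row_inj (perm_word _) (perm_word _) (A_noinv (valP v)) (A_noinv (valP u))
          (fun x _ => e x)).
Qed.

Lemma next_inj i v u u' : next i v u -> next i v u' -> u = u'.
Proof. by move=> e e'; apply: row_inj => x; rewrite e e'. Qed.

Lemma next_sym i v u : 0 < i -> next i v u -> next i u v.
Proof.
move=> i0 e x; have -> : dswap (prec_row (R u)) i = dswap (prec_row (R v)) i.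
  by rewrite -(dswap_prec_row_comp (R v) i0); apply: eq_dswap_prec_row => y _; apply: e.
by rewrite /= e /= dswapK.
Qed.

Lemma triple_letters v i : 2 <= i < n -> {subset [:: i.-1; i; i.+1] <= W v}.
Proof.
by move=> ik x; rewrite (perm_mem (perm_word _)) mem_iota !inE => /or3P[]/eqP->; lia.
Qed.

Lemma next_ex i v : 2 <= i < n -> exists2 u, W u = D_op delta i (W v) & next i v u.
Proof.
case: i => // i ik; have sw := triple_letters v ik.
have [g [pg -> NIg dg rg]] := D_step (perm_word (val v)) (A_noinv (valP v)) sw.
have [q eq] := word_surj pg.
have Aq : A q by apply: A_closed (valP v) _ _; rewrite eq.
by exists (exist _ q Aq); rewrite /next /R /W /= eq.
Qed.

Lemma nextP i v u : 2 <= i < n -> W u = D_op delta i (W v) <-> next i v u.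
Proof.
move=> ik; have [u' e nu'] := next_ex v ik; split=> [eu|nu]; last by rewrite (next_inj nu nu').
have -> // : u = u' by apply/val_inj/word_inj; apply: etrans eu (esym e).
Qed.

Lemma edgeP i v u : 2 <= i < n -> ([set v; u] \in edges G i) <-> v <> u /\ next i v u.
Proof.
move=> ik; have i0 : 0 < i by lia.
rewrite induced_edge; split.
  case/andP=> /eqP vu /orP[]/eqP e; split=> //; first exact/nextP.
  by apply: next_sym => //; apply/nextP.
case=> /eqP-> /nextP e; apply/orP; left; exact/eqP/e.
Qed.

(** The two letter triples are disjoint, so a step at one leaves the rows that determine the
    exchange at the other. *)
Lemma next_comm i j v w x y : (i + 2 < j) || (j + 2 < i) -> 0 < i -> 0 < j ->
  next i v w -> next j w x -> next j v y -> next i y x.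
Proof.
move=> ij i0 j0 vw wx vy z.
have far k l : (k + 2 < l) || (l + 2 < k) -> 0 < k -> 0 < l ->
    forall t, t \in [:: k.-1; k; k.+1] -> t \notin [:: l.-1; l; l.+1].
  by clear => kl k0 l0 t; rewrite !inE; lia.
have ji : (j + 2 < i) || (i + 2 < j) by rewrite orbC.
have ej : dswap (prec_row (R w)) j = dswap (prec_row (R v)) j.
  by apply: eq_dswap_prec_row => t tj; rewrite vw /= dswap_out // (far j i).
have ei : dswap (prec_row (R y)) i = dswap (prec_row (R v)) i.
  by apply: eq_dswap_prec_row => t tj; rewrite vy /= dswap_out // (far i j).
rewrite wx /= vw /= ei vy /= ej; congr (R v _).
exact: (dswap_comm _ _ ij i0 j0 z).
Qed.

Lemma induced_commuting : commuting G.
Proof.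
move=> i j ik jk ij v w x; have [i0 j0] : 0 < i /\ 0 < j by lia.
move=> /(edgeP _ _ ik)[vw nvw] /(edgeP _ _ jk)[wx nwx].
have [y _ nvy] := next_ex v jk.
have nyx := next_comm ij i0 j0 nvw nwx nvy.
exists y.
  (* If [y] were [v], then [w] and [x] would both be the i-step of [v]; below, if [y] were [x], then
     [v] and [w] would both be the j-step of [x]. *)
  apply/(edgeP _ _ jk); split=> // e; apply: wx.
  by apply: next_inj nvw _; rewrite e.
apply/(edgeP _ _ ik); split; last exact: next_sym.
move=> e; apply: vw; rewrite -e in nvy.
exact: next_inj (next_sym j0 nvy) (next_sym j0 nwx).
Qed.

(** * Components of the restriction to an interval *)

Section Local.
Variables (a : nat) (v0 : V).
Hypothesis an : 1 <= a <= n.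
Local Notation k := (minn 6 (n.+1 - a)).
Local Notation H := (restrict G a 6).
Let b := a.-1.

Let k6 : 0 < k <= 6. Proof. by lia. Qed.
Let bk : (b + k <= n)%N. Proof. by rewrite /b; lia. Qed.

(** The letters of the interval, [b.+1] to [b + k], are renumbered from 1 to [k], and [s v] is their
    row word. *)
Let Rb (v : V) := R v \o addn b.
Let s (v : V) := row_word k (Rb v).

Lemma perm_local v : perm_eq (s v) (iota 1 k).
Proof. exact: perm_row_word. Qed.

Lemma shift_range i : 2 <= i < k -> 2 <= (b + i)%N < n.
Proof. by have := bk; clear; lia. Qed.

Lemma next_shift i v u : 0 < i -> next (b + i)%N v u ->
  Rb u =1 Rb v \o dswap (prec_row (Rb v)) i.
Proof. by move=> i0 e x; rewrite /Rb /= e /= dswap_shift. Qed.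

Lemma next_local i v u : 2 <= i < k -> next (b + i)%N v u ->
  s u = d_op i (s v) /\ map (Rb u) (s u) = map (Rb v) (s v).
Proof.
move=> ik e; have i0 : 0 < i by lia.
have eR := next_shift i0 e.
have es := row_word_dswap ik eR.
split; first by rewrite d_op_row_word.
by rewrite [s u]es -map_comp; apply: eq_map => x; rewrite /= eR /= dswapK.
Qed.

(** Invariants of a component: together with the insertion tableau of [s], they determine a
    vertex. *)
Definition same_local (v u : V) : Prop :=
  [/\ tableau_shape (s u) = tableau_shape (s v), recording (s u) = recording (s v),
      map (Rb u) (s u) = map (Rb v) (s v)
    & forall x, x \notin iota b.+1 k -> R u x = R v x].

Lemma same_local_trans v u u' : same_local v u -> same_local u u' -> same_local v u'.
Proof.
by move=> [e1 e2 e3 e4] [f1 f2 f3 f4]; split=> [|||x xo]; rewrite ?f1 ?f2 ?f3 ?f4 ?e4.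
Qed.

Lemma next_same_local i v u : 2 <= i < k -> next (b + i)%N v u -> same_local v u.
Proof.
move=> ik e; have [es er] := next_local ik e.
have [_ sh rec] := tableau_d_op k6 (perm_local v) ik.
split; rewrite ?es ?sh ?rec -?es // => x xo.
rewrite e /= dswap_out //; apply: contra xo; rewrite !inE mem_iota.
by clear -ik; lia.
Qed.

Lemma adjP v u : reflect (exists2 i, 2 <= i < k & v <> u /\ next (b + i)%N v u)
                         (@adj H v u).
Proof.
have ab i : (a + i - 1 = b + i)%N by rewrite /b; clear -an; lia.
apply: (iffP existsP) => [[i /andP[i2]]|[i ik h]].
  have ik : 2 <= i < k by rewrite i2; apply: ltn_ord.
  rewrite /= ab => /(edgeP _ _ (shift_range ik)) h.
  by exists i.
have [i2 ilt] := andP ik; exists (Ordinal (ilt : i < deg H)); rewrite i2 /= ab.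
exact/(edgeP _ _ (shift_range ik)).
Qed.

Lemma connect_same_local v u : connect (@adj H) v u -> same_local v u.
Proof.
case/connectP => p pp ->; elim: p v pp => [v _|w p IH v /= /andP[vw pp]].
  by split.
have [i ik [_ nx]] := adjP _ _ vw.
exact: same_local_trans (next_same_local ik nx) (IH _ pp).
Qed.

Lemma connect_next i u w : 2 <= i < k -> next (b + i)%N u w ->
  connect (@adj H) v0 u -> connect (@adj H) v0 w.
Proof.
move=> ik nx cu; apply: connect_trans cu _.
have [->|ne] := eqVneq u w; first exact: connect0.
by apply: connect1; apply/adjP; exists i => //; split=> //; apply/eqP.
Qed.

Let la := tableau_shape (s v0).
Local Notation comp := {u : V | connect (@adj H) v0 u}.

Let la_sum : sumn la = k. Proof. exact: sumn_tableau_shape k6 _ (perm_local v0). Qed.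

Lemma comp_shape (u : comp) : tableau_shape (s (val u)) = la.
Proof. by have [] := connect_same_local (valP u). Qed.

(** Insertion and recording tableaux give back [s]; the common sequence of rows along [s] gives the
    rows of the interval's letters, and the other letters have their rows in common. *)
Lemma comp_word_inj (u w : comp) :
  tableau_word (s (val u)) = tableau_word (s (val w)) -> u = w.
Proof.
have [_ ru mu ou] := connect_same_local (valP u).
have [_ rw mw ow] := connect_same_local (valP w).
move=> e; have es : s (val u) = s (val w).
  by apply: (tableau_word_inj k6 (perm_local _) (perm_local _) e); rewrite ru rw.
apply/val_inj/row_inj => x.
have [xi|xo] := boolP (x \in iota b.+1 k); last by rewrite ou ?ow.
have [y yk ->] : exists2 y, y \in iota 1 k & x = (b + y)%N.
  by exists (x - b)%N; move: xi; rewrite !mem_iota; clear; lia.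
have ys : y \in s (val u) by rewrite (perm_mem (perm_local _)).
have /eq_in_map/(_ y ys) : map (Rb (val u)) (s (val u)) = map (Rb (val w)) (s (val u)).
  by rewrite mu -mw es.
by [].
Qed.

Lemma tableau_vertex (u : comp) :
  exists q : vert (tableau_graph la), word (val q) = tableau_word (s (val u)).
Proof.
have pt := perm_tableau_word k6 (perm_local (val u)).
have [q eq] : exists q : 'S_(sumn la), word q = tableau_word (s (val u)).
  by apply: word_surj; rewrite la_sum.
have sq : standard_filling (young_diagram la) (filling (young_diagram la) (word q)).
  rewrite standard_fillingE; last by rewrite (perm_size (perm_word q)) size_iota.
  by rewrite eq -(comp_shape u); apply: standard_tableau_word k6 _ (perm_local _).
by exists (exist _ q sq).
Qed.

Lemma tableau_vertex_onto (q : vert (tableau_graph la)) :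
  exists u : comp, word (val q) = tableau_word (s (val u)).
Proof.
(* The set of words attained contains that of [v0] and is closed under every d_i, so it is
   everything by connectedness. *)
pose Q r := exists u : comp, r = tableau_word (s (val u)).
have pq : perm_eq (word (val q)) (iota 1 k) by rewrite -la_sum perm_word.
have v0c : connect (@adj H) v0 v0 := connect0 _ _.
apply: (@standard_connected _ k6 Q (s v0) (tableau_word (s v0))) => //.
- exact: perm_local.
- exact: perm_tableau_word k6 _ (perm_local _).
- exact: standard_tableau_word k6 _ (perm_local _).
- rewrite -standard_fillingE; first exact: (valP q).
  by rewrite (perm_size pq) size_iota.
- move=> r i ik [u ->].
  have [w _ nx] := next_ex (val u) (shift_range ik).
  exists (exist _ w (connect_next ik nx (valP u))) => /=.
  have [-> _] := next_local ik nx.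
  by have [] := tableau_d_op k6 (perm_local (val u)) ik.
- by exists (exist _ v0 v0c).
Qed.

Lemma component_iso : scg_iso (@component H v0) (tableau_graph la).
Proof.
split; first by rewrite /= la_sum.
have [f fE] := fin_all_exists tableau_vertex.
have fi : injective f.
  by move=> u w e; apply: comp_word_inj; rewrite -!fE e.
(* Edges lift: the step from [u] has the same insertion tableau as [w], hence is [w]. *)
have fP i (u w : comp) : 2 <= i < k -> word (val (f w)) = d_op i (word (val (f u))) ->
    next (b + i)%N (val u) (val w).
  move=> ik e; have [u' _ nx] := next_ex (val u) (shift_range ik).
  have -> // : w = exist _ u' (connect_next ik nx (valP u)).
  apply: comp_word_inj; rewrite -fE e /= fE.
  have [-> _] := next_local ik nx.
  by have [] := tableau_d_op k6 (perm_local (val u)) ik.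
exists f; split.
- have [g gE] := fin_all_exists tableau_vertex_onto.
  have gK : cancel g f by move=> q; apply/val_inj/word_inj; rewrite fE gE.
  by exists g => // u; apply: fi; rewrite gK.
- move=> i u ik.
  have ii : {subset [:: i; i.+1] <= iota 1 k}.
    by move=> x; rewrite !inE mem_iota => /orP[]/eqP->; move: ik; rewrite /=; clear; lia.
  have [ii1 ii2] : i \in iota 1 k /\ i.+1 \in iota 1 k.
    by split; apply: ii; rewrite !inE eqxx ?orbT.
  have wn x : x \in iota 1 k -> (b + x)%N \in W (val u).
    by rewrite (perm_mem (perm_word _)) !mem_iota; have := bk; clear; lia.
  rewrite /= -/(prec _ _ _) fE (prec_tableau_word k6 (perm_local _)) //.
  rewrite prec_row_word //.
  have -> : (a + i - 1 = b + i)%N by rewrite /b; clear -an; lia.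
  have bi1 : (b + i).+1 \in W (val u) by rewrite -addnS; apply: wn.
  rewrite -[RHS]/(prec (W (val u)) (b + i)%N (b + i)%N.+1).
  (* Signatures agree because reading order and row order coincide on consecutive letters. *)
  have [-> _] := prec_succ (perm_word _) (A_noinv (valP (val u))) (wn _ ii1) bi1.
  by rewrite /prec_row /Rb /= addnS !ltnSn.
- move=> i u w ik; have ik' : 2 <= i < k by [].
  have ab : (a + i - 1 = b + i)%N by rewrite /b; clear -an; lia.
  have -> : ([set u; w] \in edges (@component H v0) i) =
      ([set (val u : vert G); (val w : vert G)] \in edges G (b + i)%N).
    by rewrite inE imsetU1 imset_set1 /= ab.
  rewrite induced_edge (inj_eq fi).
  apply/idP/idP => [/andP[/eqP ne h]|/(edgeP _ _ (shift_range ik'))[ne nx]].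
    apply/(edgeP _ _ (shift_range ik')); split; first by move/val_inj.
    case/orP: h => /eqP h; first exact: fP.
    by apply: next_sym; [rewrite addn_gt0; lia | exact: fP].
  apply/andP; split; first by apply/eqP => e; apply: ne; rewrite e.
  apply/orP; left; rewrite !fE; have [-> _] := next_local ik' nx.
  by have [-> _ _] := tableau_d_op k6 (perm_local (val u)) ik'.
Qed.

End Local.

Lemma induced_dual_equivalence : dual_equivalence_graph G.
Proof.
split; last exact: induced_commuting.
move=> a an v; have an' : 1 <= a <= n := an.
exists (tableau_shape (row_word (minn 6 (n.+1 - a)) (R v \o addn a.-1))).
  apply: (@tableau_shape_partition (minn 6 (n.+1 - a))); first by clear -an'; lia.
  exact: perm_row_word.
exact: component_iso.
Qed.

End Graph.

Theorem theorem3p2 (gamma delta : diagram) (gamma_sub_delta : gamma `<=` delta) :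
  dual_equivalence_graph (P_graph delta) /\
  dual_equivalence_graph (R_graph gamma delta).
Proof.
have invP (p : 'S_#|` delta|) : Defs.inv delta (filling delta (word p)) = 0 <->
    noinv delta (filling delta (word p)).
  apply: inv_eq0P; first exact: filling_inj (perm_word p).
  move=> c /(filling_mem (perm_word p)); rewrite (mem_word (perm_word p)).
  by case/andP.
(* Both vertex sets are inversion-free and closed under changes that keep inv = 0 and the
   descents. *)
split; apply: induced_dual_equivalence => [p|p q].
- by move/eqP/invP.
- by move=> _ /invP-> _.
- by case/andP=> /eqP/invP.
- by case/andP=> _ /eqP dp /invP-> ->; rewrite dp !eqxx.
Qed.
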